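(* Let $m\ge 2$, $\gamma>0$, $u>0$, and let $\delta(\gamma,u)=\sqrt{\frac{\gamma^2(m-1)^2}{u^2}+\frac14}$. For $0\le k\le \lfloor\frac m2-1\rfloor$ set $\delta_k=k+\lceil\frac m2\rceil-\frac m2$ (so $\delta_k=k$ if $m$ is even and $\delta_k=k+\frac12$ if $m$ is odd), and set $\delta_{\lfloor m/2\rfloor}=\infty$. Then the bulk-difference invariant $\mathrm{BDI}(\gamma,u)$ (defined in the context whenever $\delta(\gamma,u)\notin\{\delta_k\}$) takes exactly $\lfloor\frac m2\rfloor$ distinct values (quantum anomalous Hall phases), namely $$\mathrm{BDI}(\gamma,u)=\mathrm{BDI}_j:=\frac{m^2}{2}-2\delta_j(\delta_j+1)\quad\text{whenever}\quad \delta_j<\delta(\gamma,u)<\delta_{j+1},$$ for $0\le j\le\lfloor\frac m2-1\rfloor$.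
   Context: Let $\sigma_1,\sigma_2$ be the standard Pauli matrices and $A=\begin{pmatrix}0&0\\1&0\end{pmatrix}$. For a real number $v$ and $\kappa=k_x+ik_y\in\mathbb C\cong\mathbb R^2$, let $\hat H(\kappa;v)$ be the $2m\times 2m$ Hermitian matrix written in $m\times m$ blocks of size $2\times2$ whose $j$-th diagonal block is $u_jI_2+\begin{pmatrix}0&\bar\kappa\\ \kappa&0\end{pmatrix}$ with $u_j=\frac{v}{m-1}\big(j-\frac{m+1}{2}\big)$, whose $(j,j+1)$ block is $\gamma A$ and whose $(j+1,j)$ block is $\gamma A^*$ for $1\le j\le m-1$, all other blocks zero (valley index $+1$, AB stacking). Set $\hat H^N(\kappa)=\hat H(\kappa;u)$ and $\hat H^S(\kappa)=\hat H(\kappa;-u)$. When $\delta(\gamma,u)$ differs from all $\delta_k$, $0$ is not an eigenvalue of $\hat H^h(\kappa)$ for any $\kappa\in\mathbb R^2$, $h\in\{N,S\}$, and one defines the projector $\Pi^h(\kappa)$ onto the span of the eigenvectors of $\hat H^h(\kappa)$ with negative eigenvalues. For a smooth family of projectors $\Pi$ on $\mathbb R^2$ put $\mathcal C[\Pi]=\frac{i}{2\pi}\int_{\mathbb R^2}\mathrm{tr}\,\Pi\, d\Pi\wedge d\Pi$, with $d\Pi=\partial_{k_x}\Pi\,dk_x+\partial_{k_y}\Pi\,dk_y$. The bulk-difference invariant is $\mathrm{BDI}(\gamma,u)=\mathcal C[\Pi^S]-\mathcal C[\Pi^N]$. *)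

(* Defs.v *)
From HB Require Import structures.
From mathcomp Require Import all_boot all_order all_algebra.
From mathcomp Require Import all_classical all_reals all_analysis.
From mathcomp Require Import complex.
Set Implicit Arguments.
Unset Strict Implicit.
Unset Printing Implicit Defensive.
Import Order.TTheory GRing.Theory Num.Theory.
Import numFieldNormedType.Exports.
Local Open Scope ring_scope.
Local Open Scope complex_scope.

Section BDI.
Variable R : realType.

(* The 2m x 2m matrix \hat H(kappa; v), with kappa = kx + i ky.
   Row/column index p of 'I_(m.*2) corresponds to layer p %/ 2 (0-based,
   i.e. layer j = p %/ 2 + 1 of the paper) and sublattice p %% 2.
   u_j = v/(m-1) (j - (m+1)/2) with j the 1-based layer index. *)
Definition layer_pot (m : nat) (v : R) (j0 : nat) : R :=
  v / (m%:R - 1) * ((j0.+1)%:R - (m%:R + 1) / 2).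

Definition Hhat (m : nat) (gamma v kx ky : R) : 'M[R[i]]_(m.*2) :=
  \matrix_(p, q)
    (let j := (p %/ 2)%N in let l := (q %/ 2)%N in
     let a := (p %% 2)%N in let b := (q %% 2)%N in
     if j == l then
       (if a == b then (layer_pot m v j)%:C else
        if (a == 0%N) then (kx -i* ky)
        else (kx +i* ky))
     else if l == j.+1 then
       (if (a == 1%N) && (b == 0%N) then gamma%:C else 0)
     else if j == l.+1 then
       (if (a == 0%N) && (b == 1%N) then gamma%:C else 0)
     else 0).


Definition adjmx n (M : 'M[R[i]]_n) : 'M[R[i]]_n := (map_mx (@conjc R) M)^T.

Definition is_neg_proj n (H P : 'M[R[i]]_n) : Prop :=
  [/\ adjmx P = P, P *m P = P &
      forall (a : R[i]) (x : 'cV[R[i]]_n), x != 0 -> H *m x = a *: x ->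
        (a < 0 -> P *m x = x) /\ (~~ (a < 0) -> P *m x = 0)].

Definition negproj n (H : 'M[R[i]]_n) : 'M[R[i]]_n :=
  xget 0 [set P | is_neg_proj H P].

Definition dkx n (F : R -> R -> 'M[R[i]]_n) (kx ky : R) : 'M[R[i]]_n :=
  \matrix_(p, q) ((derive1 (fun t => complex.Re (F t ky p q)) kx)
              +i* (derive1 (fun t => complex.Im (F t ky p q)) kx)).
Definition dky n (F : R -> R -> 'M[R[i]]_n) (kx ky : R) : 'M[R[i]]_n :=
  \matrix_(p, q) ((derive1 (fun t => complex.Re (F kx t p q)) ky)
              +i* (derive1 (fun t => complex.Im (F kx t p q)) ky)).

(* Chern form density: C[Pi] = (i/2pi) \int tr Pi dPi /\ dPi,
   with dPi /\ dPi = (d_x Pi d_y Pi - d_y Pi d_x Pi) dkx /\ dky *)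
Definition chern_density n (F : R -> R -> 'M[R[i]]_n) (k : R * R) : R[i] :=
  ('i / (2 * pi)%:C) *
    \tr (F k.1 k.2 *m (dkx F k.1 k.2 *m dky F k.1 k.2
                       - dky F k.1 k.2 *m dkx F k.1 k.2)).

Definition leb2 := ((@lebesgue_measure R) \x (@lebesgue_measure R))%E.

Definition chern n (F : R -> R -> 'M[R[i]]_n) : R[i] :=
  (\int[leb2]_(k in setT) complex.Re (chern_density F k))
  +i* (\int[leb2]_(k in setT) complex.Im (chern_density F k)).

Definition PiN (m : nat) (gamma u : R) (kx ky : R) := negproj (Hhat m gamma u kx ky).
Definition PiS (m : nat) (gamma u : R) (kx ky : R) := negproj (Hhat m gamma (- u) kx ky).

Definition BDI (m : nat) (gamma u : R) : R[i] :=
  chern (PiS m gamma u) - chern (PiN m gamma u).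

Definition delta (m : nat) (gamma u : R) : R :=
  Num.sqrt (gamma ^+ 2 * (m%:R - 1) ^+ 2 / u ^+ 2 + 1 / 4).

(* delta_k = k + ceil(m/2) - m/2 (finite ones, 0 <= k <= floor(m/2 - 1));
   uphalf m = ceil(m/2) *)
Definition delta_k (m k : nat) : R := k%:R + (uphalf m)%:R - m%:R / 2.

(* "delta < delta_k" with the convention delta_{floor(m/2)} = +infinity *)
Definition below_delta (m k : nat) (x : R) : Prop :=
  if (k == m./2)%N then True else x < delta_k m k.

Definition BDI_val (m j : nat) : R :=
  m%:R ^+ 2 / 2 - 2 * delta_k m j * (delta_k m j + 1).

End BDI.

(* Main.v *)
Require Import Defs.
From HB Require Import structures.
From mathcomp Require Import all_boot all_order all_algebra.
From mathcomp Require Import all_classical all_reals all_analysis.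
From mathcomp Require Import measurable_realfun complex ring lra zify.
Set Implicit Arguments.
Unset Strict Implicit.
Unset Printing Implicit Defensive.
Import Order.TTheory GRing.Theory Num.Theory.
Import numFieldNormedType.Exports.
Local Open Scope classical_set_scope.
Local Open Scope ring_scope.
Local Open Scope complex_scope.
Import Normc.

(** With S = 1 - 2 Pi the sign of H and K = S H its absolute value, the
    derivative of S in a direction A is the unique solution X of the Sylvester
    equation K X + X K = A - S A S.  The Hamiltonian is covariant under
    rotations of kappa, with diagonal generator L = diag(ceil(p/2)); hence
    x dS/dy - y dS/dx = i [L, S], and the Chern density at distance r from the
    origin equals (1 / (4 pi r)) d/dr tr(L S(r)).  Its integral over the plane is
    (tr L S(oo) - tr L S(0)) / 2, where S(oo) is the sign of the hopping inside
    the layers and L S(oo) has trace zero.  At kappa = 0 the Hamiltonian splits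
    into two 1x1 and m - 1 2x2 blocks on which L is scalar, so tr L S(0) is a
    weighted count of the blocks that are definite, i.e. of the indices i with
    |i - m/2| > delta.  Zero is not an eigenvalue for kappa <> 0 because a flip
    of the layers anticommutes with the chain up to signs (see [chain_kernel]). *)

(** * Matrix signs and the spectral projector *)

(** The Chern density is built from entrywise derivatives of a projector picked by [xget], so
    differentiability itself has to be established. In terms of the sign, every estimate concerns a
    Sylvester equation K X + X K' = Y, whose solution is bounded by means of the coercivity constant
    of K alone. With K taken at a fixed parameter and K' at a nearby one, no control of the spectral
    gap in a neighbourhood is called for.

    The density has no definite sign, so its integrability over the plane is part of the problem. It
    comes from the inversion e = 1/r: the Hamiltonian at (r, 0) is r times a matrix that is affine
    in e and still invertible at e = 0. Hence dS/dr is O(r^-2) and the density is O(r^-3), and the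
    same inversion produces the limit S(oo). Radial integrals are computed with the slope t = y/x in
    place of the angle, the factor 2 pi arising from four copies of the integral of 1/(1 + t^2) over
    the half-line. *)

Section MatrixNorm.
Variables (R : realType) (n : nat).
Implicit Types (A B X Y : 'M[R[i]]_n).
Local Notation adj := (@adjmx R _).

Lemma adjmxM A B : adj (A *m B) = adj B *m adj A.
Proof. by rewrite /adjmx map_mxM trmx_mul. Qed.
Lemma adjmxD A B : adj (A + B) = adj A + adj B.
Proof. by rewrite /adjmx map_mxD linearD. Qed.
Lemma adjmxB A B : adj (A - B) = adj A - adj B.
Proof. by rewrite /adjmx map_mxB linearB. Qed.
Lemma adjmxK A : adj (adj A) = A.
Proof. by apply/matrixP => i j; rewrite !mxE conjcK. Qed.
Lemma adjmx1 : adj (1%:M : 'M[R[i]]_n) = 1%:M.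
Proof. by rewrite /adjmx map_mx1 trmx1. Qed.
Lemma adjmxZ (c : R) A : adj (c%:C *: A) = c%:C *: adj A.
Proof. by apply/matrixP => i j; rewrite !mxE rmorphM; congr (_ * _); exact: conjc_real. Qed.

Lemma mxtrace_adj A : \tr (adj A) = (\tr A)^*.
Proof.
rewrite /adjmx mxtrace_tr /mxtrace rmorph_sum.
by apply: eq_bigr => i _; rewrite mxE.
Qed.

Lemma ReD (x y : R[i]) : complex.Re (x + y) = complex.Re x + complex.Re y.
Proof. by case: x; case: y. Qed.
Lemma ReB (x y : R[i]) : complex.Re (x - y) = complex.Re x - complex.Re y.
Proof. by case: x; case: y. Qed.
Lemma ImB (x y : R[i]) : complex.Im (x - y) = complex.Im x - complex.Im y.
Proof. by case: x; case: y. Qed.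
Lemma Re_sum I (r : seq I) (P : pred I) (F : I -> R[i]) :
  complex.Re (\sum_(i <- r | P i) F i) = \sum_(i <- r | P i) complex.Re (F i).
Proof. by apply: (big_morph _ ReD). Qed.
Lemma Re_mulC (c : R) (x : R[i]) : complex.Re (c%:C * x) = c * complex.Re x.
Proof. by case: x => a b /=; rewrite mul0r subr0. Qed.
Lemma Im_mulC (c : R) (x : R[i]) : complex.Im (c%:C * x) = c * complex.Im x.
Proof. by case: x => a b /=; rewrite mul0r addr0. Qed.

Lemma normc_ge0 (x : R[i]) : 0 <= normc x.
Proof. by case: x => a b; exact: sqrtr_ge0. Qed.
Lemma normc_sqr (x : R[i]) : normc x ^+ 2 = complex.Re x ^+ 2 + complex.Im x ^+ 2.
Proof. by case: x => a b /=; rewrite sqr_sqrtr // addr_ge0 ?sqr_ge0. Qed.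
Lemma Re_le_normc (x : R[i]) : `|complex.Re x| <= normc x.
Proof.
rewrite -(ler_pXn2r (n:=2)) ?nnegrE ?normc_ge0 //.
by rewrite normc_sqr real_normK ?num_real // lerDl sqr_ge0.
Qed.
Lemma Im_le_normc (x : R[i]) : `|complex.Im x| <= normc x.
Proof.
rewrite -(ler_pXn2r (n:=2)) ?nnegrE ?normc_ge0 //.
by rewrite normc_sqr real_normK ?num_real // lerDr sqr_ge0.
Qed.
Lemma normc_conj (x : R[i]) : normc x^* = normc x.
Proof. by case: x => a b /=; rewrite sqrrN. Qed.
Lemma normcR (c : R) : normc c%:C = `|c|.
Proof. by rewrite /= expr0n /= addr0 sqrtr_sqr. Qed.
Lemma normc_sum I (r : seq I) (P : pred I) (F : I -> R[i]) :
  normc (\sum_(i <- r | P i) F i) <= \sum_(i <- r | P i) normc (F i).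
Proof.
elim/big_rec2: _ => [|i y x _ h]; first by rewrite normc0.
by apply: (le_trans (le_normcD _ _)); rewrite lerD2l.
Qed.

(** Two norms are in use: this one is submultiplicative and bounds entries and traces directly,
    while [frob], the squared Frobenius norm, belongs to the inner product in which coercivity is
    stated. *)
Definition l1norm A : R := \sum_i \sum_j normc (A i j).

Lemma l1norm_ge0 A : 0 <= l1norm A.
Proof. by do 2 apply: sumr_ge0 => ? _; exact: normc_ge0. Qed.

Lemma normc_entry_le A i j : normc (A i j) <= l1norm A.
Proof.
rewrite /l1norm (bigD1 i) //= (bigD1 j) //= -addrA lerDl addr_ge0 //.
  by apply: sumr_ge0 => ? _; exact: normc_ge0.
by do 2 apply: sumr_ge0 => ? _; exact: normc_ge0.
Qed.

Lemma l1normD A B : l1norm (A + B) <= l1norm A + l1norm B.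
Proof.
rewrite /l1norm -big_split /=; apply: ler_sum => i _.
rewrite -big_split /=; apply: ler_sum => j _; rewrite mxE; exact: le_normcD.
Qed.

Lemma l1normN A : l1norm (- A) = l1norm A.
Proof. by apply: eq_bigr => i _; apply: eq_bigr => j _; rewrite mxE normcN. Qed.

Lemma l1normB A B : l1norm (A - B) <= l1norm A + l1norm B.
Proof. by rewrite -(l1normN B); exact: l1normD. Qed.

Lemma l1normZ (c : R) A : l1norm (c%:C *: A) = `|c| * l1norm A.
Proof.
rewrite /l1norm mulr_sumr; apply: eq_bigr => i _.
by rewrite mulr_sumr; apply: eq_bigr => j _; rewrite mxE normcM normcR.
Qed.

Lemma l1normM A B : l1norm (A *m B) <= l1norm A * l1norm B.
Proof.
have -> : l1norm A * l1norm B =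
   \sum_i \sum_j normc (A i j) * l1norm B.
  by rewrite /l1norm mulr_suml; apply: eq_bigr => i _; rewrite mulr_suml.
apply: ler_sum => i _.
apply: (@le_trans _ _ (\sum_j \sum_k normc (A i k) * normc (B k j))).
  apply: ler_sum => j _; rewrite mxE; apply: (le_trans (normc_sum _ _ _)).
  by apply: ler_sum => k _; rewrite normcM.
rewrite exchange_big /=; apply: ler_sum => k _.
rewrite -mulr_sumr ler_wpM2l ?normc_ge0 //.
rewrite /l1norm [leRHS](bigD1 k) //= lerDl.
by do 2 apply: sumr_ge0 => ? _; exact: normc_ge0.
Qed.

Lemma normc_trace_le A : normc (\tr A) <= l1norm A.
Proof.
apply: (le_trans (normc_sum _ _ _)); apply: ler_sum => i _.
rewrite (bigD1 i) //= lerDl; apply: sumr_ge0 => ? _; exact: normc_ge0.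
Qed.

Definition frob A : R := complex.Re (\tr (adj A *m A)).

Lemma Re_trace_adj A B :
  complex.Re (\tr (adj A *m B)) = \sum_i \sum_j complex.Re ((A i j)^* * B i j).
Proof.
rewrite /mxtrace Re_sum exchange_big /=; apply: eq_bigr => j _.
by rewrite mxE Re_sum; apply: eq_bigr => i _; rewrite !mxE.
Qed.

Lemma frobE A : frob A = \sum_i \sum_j normc (A i j) ^+ 2.
Proof.
rewrite /frob Re_trace_adj; apply: eq_bigr => i _; apply: eq_bigr => j _.
by rewrite normc_sqr; case: (A i j) => a b /=; rewrite mulNr opprK -!expr2.
Qed.

Lemma frob_ge0 A : 0 <= frob A.
Proof. by rewrite frobE; do 2 apply: sumr_ge0 => ? _; exact: sqr_ge0. Qed.

Lemma normc_entry_frob A i j : normc (A i j) <= Num.sqrt (frob A).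
Proof.
rewrite -(ler_pXn2r (n:=2)) ?nnegrE ?normc_ge0 ?sqrtr_ge0 //.
rewrite sqr_sqrtr ?frob_ge0 // frobE (bigD1 i) //= (bigD1 j) //= -addrA lerDl.
rewrite addr_ge0 //; do ?[apply: sumr_ge0 => ? _]; exact: sqr_ge0.
Qed.

Lemma frob_eq0 A : frob A <= 0 -> A = 0.
Proof.
move=> h; apply/matrixP => i j; rewrite mxE.
have := normc_entry_frob A i j; rewrite ler0_sqrtr // => h2.
by apply: eq0_normc; apply/eqP; rewrite eq_le h2 normc_ge0.
Qed.

Lemma l1norm_frob A : l1norm A <= (n ^ 2)%:R * Num.sqrt (frob A).
Proof.
apply: (@le_trans _ _ (\sum_(i < n) \sum_(j < n) Num.sqrt (frob A))).
  by do 2 apply: ler_sum => ? _; exact: normc_entry_frob.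
by rewrite !sumr_const card_ord -mulrnA mulr_natl mulnn.
Qed.

(** A crude Cauchy-Schwarz inequality that already mixes the two norms, as needed in
    [sylvester_bound]. *)
Lemma Re_trace_adj_le A B :
  complex.Re (\tr (adj A *m B)) <= Num.sqrt (frob A) * l1norm B.
Proof.
rewrite Re_trace_adj /l1norm mulr_sumr; apply: ler_sum => i _.
rewrite mulr_sumr; apply: ler_sum => j _.
apply: (le_trans (ler_norm _)); apply: (le_trans (Re_le_normc _)).
by rewrite normcM normc_conj ler_wpM2r ?normc_ge0 ?normc_entry_frob.
Qed.

End MatrixNorm.

Section Sign.
Variables (R : realType) (n : nat).
Implicit Types (H S K A B X Y : 'M[R[i]]_n).
Local Notation adj := (@adjmx R _).

(** Positive definiteness with lower bound g. The test objects are square matrices, that is n column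
    vectors at once, because the unknown of a Sylvester equation is a matrix. *)
Definition coercive (g : R) K :=
  forall X, g * frob X <= complex.Re (\tr (adj X *m K *m X)).

(** Coercivity of S H, the absolute value of H, singles out the sign among the selfadjoint
    involutions that commute with H. *)
Definition is_sign H S :=
  [/\ adj S = S, S *m S = 1%:M, S *m H = H *m S
    & exists2 g, 0 < g & coercive g (S *m H)].

Definition selfadjoint H := adj H = H.

Lemma spectral_decomposition H : selfadjoint H ->
  exists (V : 'M[R[i]]_n) (d : 'I_n -> R),
    [/\ adj V *m V = 1%:M, V *m adj V = 1%:M &
     H = V *m diag_mx (\row_i (d i)%:C) *m adj V].
Proof.
move=> hH.
have hs : H \is hermsymmx.
  apply/is_hermitianmxP; rewrite expr0 scale1r -{1}hH; exact: map_trmx.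
have /hermitian_normalmx/orthomx_spectralP e := hs.
have /mxOverP dr := hermitian_spectral_diag_real hs.
have /unitarymxP uu := spectral_unitarymx H.
have aE (M : 'M[R[i]]_n) : adj M = map_mx Num.conj M^T by rewrite /adjmx map_trmx.
exists (adj (spectralmx H)), (fun i => complex.Re (spectral_diag H 0 i)).
rewrite adjmxK !aE; split; [exact: uu | exact/mulmx1C |].
have -> : \row_i (complex.Re (spectral_diag H 0 i))%:C = spectral_diag H.
  by apply/rowP => i; rewrite mxE RRe_real // dr.
by rewrite {1}e invmx_unitary // spectral_unitarymx.
Qed.

Lemma exists_sign H : selfadjoint H -> H \in unitmx -> exists S, is_sign H S.
Proof.
move=> hH uH; have [V [d [VV' VV HE]]] := spectral_decomposition hH.
have d0 i : d i != 0.
  have uV : V \in unitmx by case/mulmx1_unit : VV.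
  have uV' : adj V \in unitmx by case/mulmx1_unit : VV.
  move: uH; rewrite HE unitmx_mul unitmx_mul uV uV' andbT /=.
  rewrite unitmxE det_diag unitfE => /prodf_neq0 /(_ i isT); rewrite mxE.
  by apply: contraNN => /eqP ->.
pose D (e : 'I_n -> R) := diag_mx (\row_i (e i)%:C).
have DM e e' : D e *m D e' = D (fun i => e i * e' i).
  rewrite /D mulmx_diag; congr diag_mx; apply/rowP => i.
  by rewrite !mxE rmorphM.
have Dadj e : adj (D e) = D e.
  rewrite /D /adjmx map_diag_mx tr_diag_mx; congr diag_mx; apply/rowP => i.
  by rewrite !mxE; exact: conjc_real.
have VM e e' : V *m D e *m adj V *m (V *m D e' *m adj V) =
    V *m D (fun i => e i * e' i) *m adj V.
  rewrite !mulmxA -[X in X *m D e']mulmxA VV' mulmx1.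
  by rewrite -[X in X *m adj V]mulmxA DM.
have D1 : D (fun=> 1) = 1%:M.
  by apply/matrixP => i j; rewrite !mxE.
exists (V *m D (fun i => Num.sg (d i)) *m adj V); split.
- by rewrite !adjmxM adjmxK Dadj mulmxA.
- rewrite VM (_ : (fun i => _) = fun=> 1) ?D1 ?mulmx1 //.
  by apply/funext => i; rewrite -expr2 sqr_sg d0.
- rewrite HE -/(D d) !VM; congr (_ *m D _ *m _).
  by apply/funext => i; rewrite mulrC.
(* An explicit positive lower bound for all |d i|, which avoids a minimum over a possibly empty
   index set. *)
pose g := (1 + \sum_i `|d i|^-1)^-1.
have sum0 : 0 <= \sum_i `|d i|^-1 by apply: sumr_ge0 => i _; rewrite invr_ge0.
have gd i : g <= `|d i|.
  rewrite -[leRHS]invrK lef_pV2 ?posrE ?invr_gt0 ?normr_gt0 //; last first.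
    by rewrite ltr_wpDr.
  rewrite (bigD1 i) //= addrCA lerDl addr_ge0 //.
  by apply: sumr_ge0 => j _; rewrite invr_ge0.
exists g => [|X]; first by rewrite invr_gt0 ltr_wpDr.
rewrite HE -/(D d) VM.
have -> : (fun i => Num.sg (d i) * d i) = fun i => `|d i|.
  by apply/funext => i; rewrite normrEsg.
pose Y := adj V *m X.
have -> : frob X = frob Y.
  rewrite /frob /Y adjmxM adjmxK !mulmxA -(mulmxA (adj X)) VV mulmx1 //.
have -> : adj X *m (V *m D (fun i => `|d i|) *m adj V) *m X =
    adj Y *m (D (fun i => `|d i|) *m Y).
  by rewrite /Y adjmxM adjmxK !mulmxA.
move: Y => {X}Y; rewrite Re_trace_adj frobE mulr_sumr; apply: ler_sum => i _.
rewrite mulr_sumr; apply: ler_sum => j _.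
rewrite /D mul_diag_mx !mxE [(Y i j)^* * _]mulrCA Re_mulC.
have -> : complex.Re ((Y i j)^* * Y i j) = normc (Y i j) ^+ 2.
  by rewrite normc_sqr; case: (Y i j) => a b /=; rewrite mulNr opprK -!expr2.
by rewrite ler_wpM2r ?sqr_ge0.
Qed.


Lemma frob_scale (a : R[i]) K X : K *m X = a *: X ->
  \tr (adj X *m K *m X) = a * (frob X)%:C.
Proof.
move=> h; rewrite -mulmxA h -scalemxAr mxtraceZ; congr (_ * _).
apply/eqP; rewrite eq_complex /= eqxx /=; apply/eqP.
have : adj (adj X *m X) = adj X *m X by rewrite adjmxM adjmxK.
move/(congr1 mxtrace); rewrite mxtrace_adj.
by case: (\tr _) => x y [] /eqP; rewrite eq_sym -subr_eq0 opprK -mulr2n mulrn_eq0 => /eqP.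
Qed.

(** With P and Q the two spectral projectors, P x and Q x are eigenvectors of S H for the
    eigenvalues -a and a. Coercivity kills the one whose eigenvalue has nonpositive real part. *)
Lemma sign_neg_proj H S : selfadjoint H -> is_sign H S ->
  is_neg_proj H (2^-1%:C *: (1%:M - S)).
Proof.
move=> hH [hS SS SH [g g0 co]].
pose P := 2^-1%:C *: (1%:M - S); pose Q := 2^-1%:C *: (1%:M + S).
have two : (2^-1%:C + 2^-1%:C : R[i]) = 1.
  by rewrite -rmorphD /= -[RHS]/(1%:C); congr _%:C; field.
have PQ : P + Q = 1%:M.
  by rewrite -scalerDr addrACA addNr addr0 scalerDr -scalerDl two scale1r.
have SP : S *m P = - P.
  by rewrite -scalemxAr mulmxBr mulmx1 SS -scalerN opprB.
have SQ : S *m Q = Q.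
  by rewrite -scalemxAr mulmxDr mulmx1 SS addrC.
have PH : H *m P = P *m H.
  by rewrite -scalemxAr -scalemxAl mulmxBr mulmxBl mulmx1 mul1mx SH.
have QH : H *m Q = Q *m H.
  by rewrite -scalemxAr -scalemxAl mulmxDr mulmxDl mulmx1 mul1mx SH.
split => [||a x x0 Hx].
- by rewrite adjmxZ adjmxB adjmx1 hS.
- rewrite -/P {1}/P -scalemxAl mulmxBl mul1mx SP opprK.
  by rewrite scalerDr -scalerDl two scale1r.
(* All columns of X equal x, which turns the vector into a test matrix for coercivity. *)
pose X : 'M[R[i]]_n := x *m const_mx 1.
have HX : H *m X = a *: X by rewrite /X mulmxA Hx scalemxAl.
have back (M : 'M[R[i]]_n) : M *m X = 0 -> M *m x = 0.
  move=> /matrixP h; apply/colP => i.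
  have := h i i; rewrite !mxE => h'; rewrite -[RHS]h'; apply: eq_bigr => j _.
  by rewrite !mxE big_ord1 !mxE mulr1.
have KP : S *m H *m (P *m X) = (- a) *: (P *m X).
  rewrite -!mulmxA (mulmxA H) PH -mulmxA HX -!scalemxAr mulmxA SP mulNmx.
  by rewrite scalerN scaleNr.
have KQ : S *m H *m (Q *m X) = a *: (Q *m X).
  by rewrite -!mulmxA (mulmxA H) QH -mulmxA HX -!scalemxAr mulmxA SQ.
have fin (b : R[i]) Y : S *m H *m Y = b *: Y -> complex.Re b <= 0 -> Y = 0.
  move=> hY b0; apply: frob_eq0; have := co Y; rewrite (frob_scale hY) [b * _]mulrC Re_mulC mulrC.
  move=> h; have : frob Y * g <= 0.
    by apply: (le_trans h); rewrite mulr_ge0_le0 // frob_ge0.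
  by rewrite pmulr_lle0.
split=> ha.
- have : Q *m x = 0.
    by apply: back; apply: fin KQ _; move: ha; rewrite ltcE => /andP[_ /ltW].
  by move=> Qx; rewrite -[RHS]mul1mx -[in RHS]PQ mulmxDl Qx addr0.
- rewrite -/P; apply: back; apply: contrapT => PX0.
  have ra : complex.Re a < 0.
    rewrite ltNge; apply/negP => h; apply: PX0; apply: fin KP _.
    by move: h; case: (a) => u v /=; rewrite oppr_le0.
  have HP : H *m (P *m X) = a *: (P *m X) by rewrite mulmxA PH -mulmxA HX -scalemxAr.
  (* In the order of the complex numbers a < 0 also says that a is real; selfadjointness of H
     provides this as soon as P X is nonzero. *)
  have ia : complex.Im a = 0.
    have := frob_scale HP => e.
    have e2 Z : (\tr (adj Z *m H *m Z))^* = \tr (adj Z *m H *m Z).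
      by rewrite -mxtrace_adj !adjmxM adjmxK hH mulmxA.
    move: (e2 (P *m X)); rewrite e => /(congr1 (@complex.Im R)); rewrite mulrC.
    case: (a) => u v /=; rewrite !mul0r !addr0 => /eqP.
    rewrite eq_sym -subr_eq0 opprK -mulr2n mulrn_eq0 /= mulf_eq0 => /orP[/eqP f0|/eqP //].
    by case: PX0; apply: frob_eq0; rewrite f0.
  by move: ha; rewrite ltcE /= ia eqxx ra.
Qed.

(** Both projectors are prescribed on every eigenvector, and the columns of V are an eigenbasis. *)
Lemma neg_proj_unique H P P' : selfadjoint H ->
  is_neg_proj H P -> is_neg_proj H P' -> P = P'.
Proof.
move=> hH [_ _ hP] [_ _ hP']; have [V [d [VV' VV HE]]] := spectral_decomposition hH.
suff : P *m V = P' *m V.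
  by move/(congr1 (mulmx^~ (adj V))); rewrite -!mulmxA VV !mulmx1.
apply/matrixP => i j.
have mulV_col (M : 'M[R[i]]_n) : (M *m V) i j = (M *m col j V) i 0.
  by rewrite !mxE; apply: eq_bigr => k _; rewrite mxE.
rewrite !mulV_col; congr (_ i 0).
have c0 : col j V != 0.
  apply/eqP => c0; have /matrixP/(_ j j) := VV'; rewrite !mxE eqxx big1.
    by move/eqP; rewrite eq_sym oner_eq0.
  by move=> k _; have /colP/(_ k) := c0; rewrite !mxE => ->; rewrite mulr0.
have Hc : H *m col j V = (d j)%:C *: col j V.
  rewrite {1}HE -!mulmxA colE (mulmxA (adj V)) VV' mul1mx scalemxAr.
  congr (_ *m _); apply/colP => k; rewrite mul_diag_mx !mxE.
  by case: eqVneq => [->|]; rewrite //= !mulr0.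
have [h1 h2] := hP _ _ c0 Hc; have [h1' h2'] := hP' _ _ c0 Hc.
by case: (boolP ((d j)%:C < 0)) => hd; [rewrite h1 // h1'|rewrite h2 // h2'].
Qed.

(** Existence and uniqueness make [xget] return the true projector and not its default value 0. *)
Lemma negproj_sign H S : selfadjoint H -> is_sign H S ->
  negproj H = 2^-1%:C *: (1%:M - S).
Proof.
move=> hH hS; rewrite /negproj; case: xgetP => [P _ hP|h].
  exact: neg_proj_unique hH hP (sign_neg_proj hH hS).
by have := h _ (sign_neg_proj hH hS).
Qed.

End Sign.

(** * Sylvester equations and perturbation of the sign *)

(* [mulmxBl] and its companions type the products in [pzRingType], which differs
   syntactically from the [pzSemiRingType] products of statements; these
   specialisations keep one form, so that products can be abstracted. *)
Section ComplexMulmx.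
Variables (R : realType) (n : nat).
Implicit Types A B C : 'M[R[i]]_n.
Lemma cmulmxBl A B C : (A - B) *m C = A *m C - B *m C.
Proof. exact: mulmxBl. Qed.
Lemma cmulmxBr A B C : A *m (B - C) = A *m B - A *m C.
Proof. exact: mulmxBr. Qed.
Lemma cmulmxDl A B C : (A + B) *m C = A *m C + B *m C.
Proof. exact: mulmxDl. Qed.
Lemma cmulmxDr A B C : A *m (B + C) = A *m B + A *m C.
Proof. exact: mulmxDr. Qed.
Lemma cmulNmx A B : (- A) *m B = - (A *m B).
Proof. exact: mulNmx. Qed.
Lemma cmulmxN A B : A *m (- B) = - (A *m B).
Proof. exact: mulmxN. Qed.
Lemma cmulmxZl (c : R[i]) A B : (c *: A) *m B = c *: (A *m B).
Proof. by rewrite scalemxAl. Qed.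
Lemma cmulmxZr (c : R[i]) A B : A *m (c *: B) = c *: (A *m B).
Proof. by rewrite scalemxAr. Qed.
Lemma cmulmxA A B C : A *m (B *m C) = A *m B *m C.
Proof. exact: mulmxA. Qed.
Definition cmulmxE := (cmulmxBl, cmulmxBr, cmulmxDl, cmulmxDr, cmulNmx,
  cmulmxN, cmulmxZl, cmulmxZr, cmulmxA).
End ComplexMulmx.

(** Distributes, then abstracts each product as an atom: what remains is a linear identity, settled
    entrywise by [ring]. *)
Ltac mx_additive :=
  rewrite ?cmulmxE;
  repeat match goal with |- context [@mulmx ?R ?m ?n ?p ?a ?b] =>
    let x := fresh "x" in generalize (@mulmx R m n p a b); intro x end;
  apply/matrixP => ? ?; rewrite !mxE; ring.

Section Sylvester.
Variables (R : realType) (n : nat).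
Implicit Types (H S K A B X Y : 'M[R[i]]_n).
Local Notation adj := (@adjmx R _).

Lemma coercive0 g K : 0 < g -> coercive g K -> coercive 0 K.
Proof.
move=> g0 co X; apply: le_trans (co X).
by rewrite mul0r mulr_ge0 ?frob_ge0 // ltW.
Qed.

(** Pairing the right-hand side with X gives g |X|^2 from the term K X and something nonnegative
    from X K'. The bound depends on g only, so K' may come from another parameter whose own constant
    is unknown. *)
Lemma sylvester_bound g K K' X : 0 < g -> coercive g K -> coercive 0 K' ->
  l1norm X <= (n ^ 2)%:R / g * l1norm (K *m X + X *m K').
Proof.
move=> g0 co co'; set Y := K *m X + X *m K'.
set s := Num.sqrt (frob X).
have s0 : 0 <= s by exact: sqrtr_ge0.
have h1 : g * s ^+ 2 <= s * l1norm Y.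
  apply: (le_trans _ (Re_trace_adj_le X Y)).
  rewrite sqr_sqrtr ?frob_ge0 // /Y mulmxDr mxtraceD ReD -[leLHS]addr0 lerD //.
    by rewrite mulmxA; exact: co.
  have := co' (adj X); rewrite mul0r adjmxK.
  by rewrite [\tr (X *m K' *m _)]mxtrace_mulC.
have h2 : g * s <= l1norm Y.
  have [->|sn0] := eqVneq s 0; first by rewrite mulr0 l1norm_ge0.
  have sp : 0 < s by rewrite lt_def sn0.
  by rewrite -(ler_pM2l sp) mulrCA -expr2.
apply: (le_trans (l1norm_frob X)); rewrite -mulrA ler_wpM2l //.
by rewrite ler_pdivlMl.
Qed.

Lemma sylvester_inj g K X : 0 < g -> coercive g K ->
  K *m X + X *m K = 0 -> X = 0.
Proof.
move=> g0 co e; have := sylvester_bound X g0 co (coercive0 g0 co).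
rewrite e.
have -> : l1norm (0 : 'M[R[i]]_n) = 0.
  by rewrite /l1norm big1 // => i _; rewrite big1 // => j _; rewrite mxE normc0.
rewrite mulr0 => h; apply/matrixP => i j; rewrite mxE.
apply: eq0_normc; apply/eqP; rewrite eq_le normc_ge0 andbT.
exact: le_trans (normc_entry_le X i j) h.
Qed.

(** In finite dimension the injective linear map X |-> K X + X K is onto. *)
Lemma sylvester_surj g K Y : 0 < g -> coercive g K ->
  exists X, K *m X + X *m K = Y.
Proof.
move=> g0 co; pose f : {linear 'M[R[i]]_n -> 'M[R[i]]_n} := (mulmx K \+ mulmxr K)%R.
pose M := lin_mx f.
have fM : row_free M.
  apply: inj_row_free => v hv; rewrite -[v]vec_mxK.
  rewrite (_ : vec_mx v = 0) ?linear0 //.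
  apply: sylvester_inj g0 co _.
  by move: hv; rewrite mul_rV_lin => /eqP; rewrite mxvec_eq0 => /eqP.
exists (vec_mx (mxvec Y *m invmx M)).
have uM : M \in unitmx by rewrite -row_free_unit.
have : mxvec (f (vec_mx (mxvec Y *m invmx M))) = mxvec Y.
  by rewrite -mul_rV_lin mulmxKV.
by move/(can_inj mxvecK).
Qed.

(** The limit form of the difference identity [sign_diff]; that X really is a derivative is the
    content of [sign_taylor]. *)
Definition sign_deriv H S B X :=
  S *m H *m X + X *m (S *m H) = B - S *m B *m S.

Lemma exists_sign_deriv H S B : is_sign H S -> exists X, sign_deriv H S B X.
Proof. by move=> [_ _ _ [g g0 co]]; exact: sylvester_surj g0 co. Qed.

Lemma sign_deriv_unique H S B X X' : is_sign H S ->
  sign_deriv H S B X -> sign_deriv H S B X' -> X = X'.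
Proof.
move=> [_ _ _ [g g0 co]] h h'; apply/eqP; rewrite -subr_eq0; apply/eqP.
apply: sylvester_inj g0 co _.
by rewrite mulmxBr mulmxBl addrACA -opprD h h' subrr.
Qed.

Lemma sign_deriv_herm H S B X : selfadjoint H -> selfadjoint B -> is_sign H S ->
  sign_deriv H S B X -> selfadjoint X.
Proof.
move=> hH hB hs h; apply: (sign_deriv_unique hs _ h).
have [hS SS SH _] := hs; move/(congr1 adj): h.
by rewrite /sign_deriv [adj (B - _)]adjmxB adjmxD !adjmxM hS hH hB -SH !mulmxA addrC.
Qed.

(** The derivative of S^2 = 1, obtained algebraically: S commutes with S H, so S X + X S solves the
    Sylvester equation with right-hand side S Y + Y S, where Y = B - S B S, and this is zero. *)
Lemma sign_deriv_anticomm H S B X : is_sign H S -> sign_deriv H S B X ->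
  S *m X = - (X *m S).
Proof.
move=> hs h; have [hS SS SH [g g0 co]] := hs.
apply/eqP; rewrite -addr_eq0; apply/eqP; apply: sylvester_inj g0 co _.
have KS : S *m H *m S = S *m (S *m H) by rewrite SH mulmxA -SH.
have -> : S *m H *m (S *m X + X *m S) + (S *m X + X *m S) *m (S *m H) =
  S *m (S *m H *m X + X *m (S *m H)) + (S *m H *m X + X *m (S *m H)) *m S.
  move: (S *m H) KS => K KS.
  rewrite !(mulmxDl, mulmxDr) !mulmxA KS -(mulmxA X K S) KS !mulmxA.
  by rewrite addrACA.
rewrite h mulmxBr mulmxBl !mulmxA SS mul1mx -(mulmxA _ S S) SS mulmx1.
by rewrite addrC addrA subrK subrr.
Qed.

(** A selfadjoint involution has squared Frobenius norm n, so signs are bounded uniformly in the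
    parameter. *)
Lemma l1norm_sign H S : is_sign H S -> l1norm S <= (n ^ 2)%:R * Num.sqrt n%:R.
Proof.
move=> [hS SS _ _]; apply: (le_trans (l1norm_frob S)).
rewrite /frob hS SS mxtrace1.
by have -> : complex.Re (n%:R : R[i]) = n%:R :> R by rewrite -(rmorph_nat (real_complex R)).
Qed.

(* An exact identity, not an expansion: together with [sylvester_bound] it
   yields Lipschitz continuity of the sign without any prior smoothness. *)
Lemma sign_diff H S H' S' : is_sign H S -> is_sign H' S' ->
  S *m H *m (S' - S) + (S' - S) *m (S' *m H') =
  (H' - H) - S *m (H' - H) *m S'.
Proof.
move=> [_ SS SH _] [_ SS' SH' _].
have e1 : S *m H *m S = H by rewrite SH -mulmxA SS mulmx1.
have e2 : S' *m (S' *m H') = H' by rewrite mulmxA SS' mul1mx.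
have e3 : S *m (S' *m H') = S *m H' *m S' by rewrite SH' mulmxA.
rewrite (mulmxBr (S *m H)) (mulmxBl S') e1 e2 e3 (mulmxBr S) mulmxBl opprB.
by rewrite addrC addrACA [RHS]addrACA; congr (_ + _); rewrite addrC.
Qed.

Definition lipschitz_at (f : R -> 'M[R[i]]_n) (t0 : R) := exists C : R,
  exists2 e : R, 0 < e &
  forall t, `|t - t0| < e -> l1norm (f t - f t0) <= C * `|t - t0|.

Lemma lipschitz_at_ge0 f t0 : lipschitz_at f t0 -> exists2 C : R, 0 <= C &
  exists2 e : R, 0 < e & forall t, `|t - t0| < e ->
    l1norm (f t - f t0) <= C * `|t - t0|.
Proof.
move=> [C [e e0 h]]; exists `|C| => //; exists e => // t /h /le_trans; apply.
by rewrite ler_wpM2r // ler_norm.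
Qed.

Lemma lipschitz_cst A t0 : lipschitz_at (fun=> A) t0.
Proof.
exists 0; exists 1 => // t _; rewrite subrr mul0r.
by rewrite /l1norm big1 // => i _; rewrite big1 // => j _; rewrite mxE normc0.
Qed.

Lemma lipschitzD f h t0 : lipschitz_at f t0 -> lipschitz_at h t0 ->
  lipschitz_at (fun t => f t + h t) t0.
Proof.
move=> [C [e e0 hf]] [D [d d0 hh]]; exists (C + D); exists (Order.min e d).
  by rewrite lt_min e0.
move=> t; rewrite lt_min => /andP[/hf h1 /hh h2].
rewrite opprD addrACA mulrDl; apply: (le_trans (l1normD _ _)); exact: lerD.
Qed.

Lemma lipschitzN f t0 : lipschitz_at f t0 -> lipschitz_at (fun t => - f t) t0.
Proof.
move=> [C [e e0 hf]]; exists C; exists e => // t /hf.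
by rewrite -opprD l1normN.
Qed.

Lemma lipschitzB f h t0 : lipschitz_at f t0 -> lipschitz_at h t0 ->
  lipschitz_at (fun t => f t - h t) t0.
Proof. by move=> hf hh; apply: lipschitzD hf (lipschitzN hh). Qed.

Lemma lipschitzM f h t0 : lipschitz_at f t0 -> lipschitz_at h t0 ->
  lipschitz_at (fun t => f t *m h t) t0.
Proof.
move=> /lipschitz_at_ge0[C C0 [e e0 hf]] /lipschitz_at_ge0[D D0 [d d0 hh]].
exists (C * (D * d + l1norm (h t0)) + l1norm (f t0) * D).
exists (Order.min e d); first by rewrite lt_min e0.
move=> t; rewrite lt_min => /andP[/hf h1 td]; have h2 := hh t td.
have -> : f t *m h t - f t0 *m h t0 =
   (f t - f t0) *m h t + f t0 *m (h t - h t0).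
  by rewrite mulmxBl mulmxBr addrA subrK.
have hb : l1norm (h t) <= D * d + l1norm (h t0).
  rewrite -[h t](subrK (h t0)); apply: (le_trans (l1normD _ _)).
  by rewrite lerD2r (le_trans h2) // ler_wpM2l // ltW.
apply: (le_trans (l1normD _ _)); rewrite mulrDl lerD //.
  apply: (le_trans (l1normM _ _)); rewrite mulrAC ler_pM ?l1norm_ge0 //.
apply: (le_trans (l1normM _ _)); rewrite -mulrA ler_wpM2l ?l1norm_ge0 //.
Qed.

Lemma lipschitz_affine A B t0 : lipschitz_at (fun t => A + t%:C *: B) t0.
Proof.
exists (l1norm B); exists 1 => // t _.
by rewrite opprD addrACA subrr add0r -scalerBl -rmorphB l1normZ mulrC.
Qed.

Section Perturbation.
Variables (H S : R -> 'M[R[i]]_n).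
Hypothesis Hsign : forall t, is_sign (H t) (S t).

Lemma lipschitz_sign t0 : lipschitz_at H t0 -> lipschitz_at S t0.
Proof.
move=> /lipschitz_at_ge0[C C0 [e e0 hH]].
have [_ _ _ [g g0 co]] := Hsign t0.
pose s : R := (n ^ 2)%:R * Num.sqrt n%:R.
have sS t : l1norm (S t) <= s by exact: l1norm_sign.
exists ((n ^ 2)%:R / g * (1 + s * s) * C); exists e => // t /hH h.
have [_ _ _ [g' g0' co']] := Hsign t.
have := sylvester_bound (S t - S t0) g0 co (coercive0 g0' co').
rewrite sign_diff // => /le_trans; apply.
rewrite -[leRHS]mulrA -[leRHS]mulrA ler_wpM2l ?divr_ge0 ?ler0n ?(ltW g0) //.
apply: (le_trans (l1normB _ _)).
apply: (@le_trans _ _ ((1 + s * s) * l1norm (H t - H t0))).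
  rewrite mulrDl mul1r lerD2l.
  apply: (le_trans (l1normM _ _)).
  rewrite mulrAC ler_pM ?l1norm_ge0 //.
  apply: (le_trans (l1normM _ _)); rewrite ler_wpM2r ?l1norm_ge0 //.
by rewrite ler_wpM2l // addr_ge0 // mulr_ge0 // (le_trans (l1norm_ge0 _) (sS t0)).
Qed.

Lemma lipschitz_abs t0 : lipschitz_at H t0 -> lipschitz_at (fun t => S t *m H t) t0.
Proof. by move=> h; apply: lipschitzM => //; apply: lipschitz_sign. Qed.

(** The increment of X solves a Sylvester equation with K at t0 on the left and K at t on the right;
    its right-hand side is of first order apart from the term dK dX, which is absorbed into the
    left-hand side. *)
Lemma lipschitz_sign_deriv B (X : R -> 'M[R[i]]_n) t0 : lipschitz_at H t0 ->
  (forall t, sign_deriv (H t) (S t) B (X t)) -> lipschitz_at X t0.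
Proof.
move=> hH hX.
have /lipschitz_at_ge0[C C0 [e e0 hK]] := lipschitz_abs hH.
pose r t := B - S t *m B *m S t.
have /lipschitz_at_ge0[D D0 [d d0 hr]] : lipschitz_at r t0.
  apply: lipschitzB; first exact: lipschitz_cst.
  apply: lipschitzM; last exact: lipschitz_sign.
  apply: lipschitzM; last exact: lipschitz_cst.
  exact: lipschitz_sign.
have [_ _ _ [g g0 co]] := Hsign t0.
pose c := (n ^ 2)%:R / g : R.
have c0 : 0 <= c by rewrite divr_ge0 // ltW.
(* Within this radius c C |t - t0| is at most 1/2, which permits the absorption in [b1]. *)
pose w := (2 * (c * C) + 1)^-1.
have cC0 : 0 <= c * C by rewrite mulr_ge0.
have wp : 0 < 2 * (c * C) + 1 by lra.
exists (2 * (c * (D + 2 * (C * l1norm (X t0))))).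
exists (Order.min (Order.min e d) w); first by rewrite !lt_min e0 d0 invr_gt0.
move=> t; rewrite !lt_min => /andP[/andP[/hK hk /hr hr'] tw].
have [_ _ _ [g' g0' co']] := Hsign t.
have := sylvester_bound (X t - X t0) g0 co (coercive0 g0' co').
set dK := S t *m H t - S t0 *m H t0 in hk.
set dX := X t - X t0.
have -> : S t0 *m H t0 *m dX + dX *m (S t *m H t) =
    r t - r t0 - dK *m dX - (dK *m X t0 + X t0 *m dK).
  rewrite /r -!hX /dK /dX.
  move: (S t *m H t) (S t0 *m H t0) (X t) (X t0) => K' K Y Y0.
  by mx_additive.
move=> hb.
have b1 : c * l1norm (dK *m dX) <= 2^-1 * l1norm dX.
  apply: (@le_trans _ _ (c * (C * `|t - t0|) * l1norm dX)).
    rewrite -mulrA ler_wpM2l //; apply: (le_trans (l1normM _ _)).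
    by rewrite ler_wpM2r ?l1norm_ge0.
  rewrite ler_wpM2r ?l1norm_ge0 //.
  apply: (@le_trans _ _ (c * C * w)); first by rewrite -mulrA ler_wpM2l // ler_wpM2l // ltW.
  by rewrite /w ler_pdivrMr //; lra.
have b2 : l1norm (dK *m X t0 + X t0 *m dK) <= 2 * (C * l1norm (X t0)) * `|t - t0|.
  apply: (le_trans (l1normD _ _)); rewrite mulr_natl mulr2n mulrDl lerD //.
    apply: (le_trans (l1normM _ _)).
    by rewrite mulrAC ler_wpM2r ?l1norm_ge0.
  apply: (le_trans (l1normM _ _)).
  by rewrite mulrC mulrAC ler_wpM2r ?l1norm_ge0.
have : l1norm dX <= c * (D * `|t - t0|) + 2^-1 * l1norm dX
     + c * (2 * (C * l1norm (X t0)) * `|t - t0|).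
  apply: (le_trans hb); rewrite -/c.
  apply: (@le_trans _ _ (c * (l1norm (r t - r t0) + l1norm (dK *m dX) +
     l1norm (dK *m X t0 + X t0 *m dK)))).
    rewrite ler_wpM2l //; apply: (le_trans (l1normB _ _)); rewrite lerD2r.
    exact: l1normB.
  by rewrite !mulrDr !lerD // ler_wpM2l.
lra.
Qed.

(** The first-order remainder again solves a Sylvester equation, with right-hand side -h (S A dS + X
    dK). Both increments are O(h), so the error is quadratic. *)
Lemma sign_taylor A X t0 : (forall t, H t = H t0 + (t - t0)%:C *: A) ->
  sign_deriv (H t0) (S t0) A X ->
  exists2 C : R, 0 <= C & exists2 e, 0 < e & forall t, `|t - t0| < e ->
    l1norm (S t - S t0 - (t - t0)%:C *: X) <= C * `|t - t0| ^+ 2.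
Proof.
move=> HA hX.
have hH : lipschitz_at H t0.
  exists (l1norm A); exists 1 => // t _.
  by rewrite HA addrAC subrr add0r l1normZ mulrC.
have /lipschitz_at_ge0[C C0 [e e0 hK]] := lipschitz_abs hH.
have /lipschitz_at_ge0[D D0 [d d0 hS]] := lipschitz_sign hH.
have [_ _ _ [g g0 co]] := Hsign t0.
pose c := (n ^ 2)%:R / g : R.
have c0 : 0 <= c by rewrite divr_ge0 // ltW.
exists (c * (l1norm (S t0 *m A) * D + l1norm X * C)).
  by rewrite mulr_ge0 // addr_ge0 // mulr_ge0 // l1norm_ge0.
exists (Order.min e d); first by rewrite lt_min e0.
move=> t; rewrite lt_min => /andP[/hK hk /hS hs].
have [_ _ _ [g' g0' co']] := Hsign t.
set h := t - t0 in hk hs *.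
have := sylvester_bound (S t - S t0 - h%:C *: X) g0 co (coercive0 g0' co').
set dS := S t - S t0 in hs *.
set dK := S t *m H t - S t0 *m H t0 in hk.
have -> : S t0 *m H t0 *m (dS - h%:C *: X) + (dS - h%:C *: X) *m (S t *m H t) =
   - (h%:C *: (S t0 *m A *m dS + X *m dK)).
  have e1 := sign_diff (Hsign t0) (Hsign t).
  have dH : H t - H t0 = h%:C *: A by rewrite HA addrAC subrr add0r.
  rewrite dH in e1.
  have KE : S t *m H t = S t0 *m H t0 + dK by rewrite addrC subrK.
  have e2 : X *m (S t *m H t) = A - S t0 *m A *m S t0 - S t0 *m H t0 *m X + X *m dK.
    by rewrite -hX KE; mx_additive.
  rewrite cmulmxBr cmulmxBl addrACA -opprD e1 cmulmxZl e2 /dS.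
  by mx_additive.
move=> /le_trans; apply; rewrite -/c -mulrA ler_wpM2l // l1normN l1normZ.
rewrite expr2 mulrCA ler_wpM2l // mulrDl.
apply: (le_trans (l1normD _ _)); rewrite lerD //; apply: (le_trans (l1normM _ _)).
  by rewrite -mulrA ler_wpM2l ?l1norm_ge0.
by rewrite -mulrA ler_wpM2l ?l1norm_ge0.
Qed.

End Perturbation.
End Sylvester.

(** * Real derivatives and continuity of entries and traces along a line *)

Section RealDerivative.
Variable R : realType.

Lemma is_derive_quadratic (f : R -> R) (a t0 C e : R) : 0 <= C -> 0 < e ->
  (forall t, `|t - t0| < e -> `|f t - f t0 - (t - t0) * a| <= C * `|t - t0| ^+ 2) ->
  is_derive t0 1 f a.
Proof.
move=> C0 e0 hf.
have cv : h^-1 *: (f (h *: 1 + t0) - f t0) @[h --> 0^'] --> a.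
  apply/cvgrPdist_le => eps eps0; near=> h.
  have h0 : h != 0 by near: h; exact: nbhs_dnbhs_neq.
  have [he hd] : `|h| < e /\ `|h| < eps / (C + 1).
    by split; near: h; apply: dnbhs0_lt => //; rewrite divr_gt0 // ltr_wpDl.
  have := hf (h + t0); rewrite addrK => /(_ he) hb.
  rewrite /GRing.scale /= mulr1 -normrN opprB.
  have -> : h^-1 * (f (h + t0) - f t0) - a = h^-1 * (f (h + t0) - f t0 - h * a).
    by field.
  rewrite normrM normfV ler_pdivrMl ?normr_gt0 //.
  apply: (le_trans hb); rewrite expr2 mulrCA ler_wpM2l //.
  apply: (@le_trans _ _ (C * (eps / (C + 1)))); first by rewrite ler_wpM2l // ltW.
  rewrite mulrCA ger_pMr // ler_pdivrMr ?mul1r ?lerDl //.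
  by rewrite ltr_wpDl.
apply: DeriveDef; last by apply: cvg_lim.
by apply/cvg_ex; exists a.
Unshelve. all: by end_near. Qed.

Lemma continuous_lipschitz (f : R -> R) (t0 C e : R) : 0 <= C -> 0 < e ->
  (forall t, `|t - t0| < e -> `|f t - f t0| <= C * `|t - t0|) ->
  {for t0, continuous f}.
Proof.
move=> C0 e0 hf; apply/cvgrPdist_le => eps eps0; near=> t.
have [he hd] : `|t - t0| < e /\ `|t - t0| < eps / (C + 1).
  split; rewrite distrC; near: t; apply: cvgr_dist_lt => //.
  by rewrite divr_gt0 // ltr_wpDl.
rewrite distrC; apply: (le_trans (hf _ he)).
apply: (@le_trans _ _ (C * (eps / (C + 1)))); first by rewrite ler_wpM2l // ltW.
rewrite mulrCA ger_pMr // ler_pdivrMr ?mul1r ?lerDl //.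
by rewrite ltr_wpDl.
Unshelve. all: by end_near. Qed.

Variable n : nat.

Lemma continuous_Re_trace (f : R -> 'M[R[i]]_n) t0 : lipschitz_at f t0 ->
  {for t0, continuous (fun t => complex.Re (\tr (f t)))}.
Proof.
move=> /lipschitz_at_ge0[C C0 [e e0 h]].
apply: (continuous_lipschitz C0 e0) => t te; rewrite -ReB -raddfB.
exact: le_trans (Re_le_normc _) (le_trans (normc_trace_le _) (h t te)).
Qed.

Variables H S : R -> 'M[R[i]]_n.
Hypothesis Hsign : forall t, is_sign (H t) (S t).
Variables (A X : 'M[R[i]]_n) (t0 : R).
Hypothesis HA : forall t, H t = H t0 + (t - t0)%:C *: A.
Hypothesis hX : sign_deriv (H t0) (S t0) A X.

Lemma is_derive_Re_sign p q :
  is_derive t0 1 (fun t => complex.Re (S t p q)) (complex.Re (X p q)).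
Proof.
have [C C0 [e e0 h]] := sign_taylor Hsign HA hX.
apply: (is_derive_quadratic C0 e0) => t te.
have := le_trans (normc_entry_le _ p q) (h t te); rewrite !mxE.
by apply: le_trans; apply: le_trans (Re_le_normc _); rewrite !ReB Re_mulC.
Qed.

Lemma is_derive_Im_sign p q :
  is_derive t0 1 (fun t => complex.Im (S t p q)) (complex.Im (X p q)).
Proof.
have [C C0 [e e0 h]] := sign_taylor Hsign HA hX.
apply: (is_derive_quadratic C0 e0) => t te.
have := le_trans (normc_entry_le _ p q) (h t te); rewrite !mxE.
by apply: le_trans; apply: le_trans (Im_le_normc _); rewrite !ImB Im_mulC.
Qed.

Lemma is_derive_Re_trace_sign (L : 'M[R[i]]_n) :
  is_derive t0 1 (fun t => complex.Re (\tr (L *m S t))) (complex.Re (\tr (L *m X))).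
Proof.
have [C C0 [e e0 h]] := sign_taylor Hsign HA hX.
apply: (@is_derive_quadratic _ _ _ (l1norm L * C) e) => //.
  by rewrite mulr_ge0 // l1norm_ge0.
move=> t te; rewrite -Re_mulC -!ReB -mxtraceZ -!raddfB /= scalemxAr -!mulmxBr.
apply: (le_trans (Re_le_normc _)); apply: (le_trans (normc_trace_le _)).
by rewrite -mulrA; apply: (le_trans (l1normM _ _)); rewrite ler_wpM2l ?l1norm_ge0 ?h.
Qed.

End RealDerivative.

(** * Integrals of radial functions *)

Section Tonelli.
Context d1 d2 (T1 : measurableType d1) (T2 : measurableType d2) (R : realType).
Variable m1 : {sigma_finite_measure set T1 -> \bar R}.
Variable m2 : {sigma_finite_measure set T2 -> \bar R}.
Variable f : T1 * T2 -> \bar R.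
Hypotheses (mf : measurable_fun setT f) (f0 : forall z, (0 <= f z)%E).
Variables (D1 : set T1) (D2 : set T2).
Hypotheses (mD1 : measurable D1) (mD2 : measurable D2).

(** Extension of f by zero off the rectangle reduces this to the whole product space. *)
Lemma tonelli_on : (\int[m1]_(x in D1) \int[m2]_(y in D2) f (x, y) =
   \int[m2]_(y in D2) \int[m1]_(x in D1) f (x, y))%E.
Proof.
pose g := f \_ (D1 `*` D2).
have mg : measurable_fun setT g.
  apply/(measurable_restrictT f); first exact: measurableX.
  exact: measurable_funTS.
have g0 z : (0 <= g z)%E by rewrite /g patchE; case: ifP.
rewrite integral_mkcond [RHS]integral_mkcond.
have e1 x : (\int[m2]_y g (x, y))%E =
    ((fun x => \int[m2]_(y in D2) f (x, y)) \_ D1)%E x.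
  rewrite patchE; case: ifPn => xD.
    rewrite [RHS]integral_mkcond; apply: eq_integral => y _.
    by rewrite /g !patchE in_setX /= xD.
  by rewrite integral0_eq // => y _; rewrite /g patchE in_setX /= (negPf xD).
have e2 y : (\int[m1]_x g (x, y))%E =
    ((fun y => \int[m1]_(x in D1) f (x, y)) \_ D2)%E y.
  rewrite patchE; case: ifPn => yD.
    rewrite [RHS]integral_mkcond; apply: eq_integral => x _.
    by rewrite /g !patchE in_setX /= yD andbT.
  by rewrite integral0_eq // => x _; rewrite /g patchE in_setX /= (negPf yD) andbF.
under eq_integral do rewrite -e1.
by under [RHS]eq_integral do rewrite -e2; exact: fubini_tonelli.
Qed.

Lemma measurable_fun_partial_integral :
  measurable_fun setT (fun x => \int[m2]_(y in D2) f (x, y))%E.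
Proof.
pose g := f \_ (setT `*` D2).
have mg : measurable_fun setT g.
  apply/(measurable_restrictT f); first exact: measurableX.
  exact: measurable_funTS.
have g0 z : (0 <= g z)%E by rewrite /g patchE; case: ifP.
have := @measurable_fun_fubini_tonelli_F _ _ _ _ R m2 g mg g0.
congr (measurable_fun _ _); apply/funext => x.
rewrite [RHS]integral_mkcond; apply: eq_integral => y _.
by rewrite /g !patchE in_setX /= in_setT.
Qed.

End Tonelli.

Section Radial.
Variable R : realType.
Local Notation mu := (@lebesgue_measure R).
Let TR : measurableType _ := measurableTypeR R.

Definition hypot (x y : R) := Num.sqrt (x ^+ 2 + y ^+ 2).

Lemma continuous_hypot x : continuous (hypot x).
Proof.
move=> y; suff : {for y, continuous (Num.sqrt \o (fun y => x ^+ 2 + y ^+ 2))} by [].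
apply: continuous_comp.
  apply: cvgD; first exact: cvg_cst.
  exact: exprn_continuous.
exact: sqrt_continuous.
Qed.

Lemma hypotC x y : hypot x y = hypot y x.
Proof. by rewrite /hypot addrC. Qed.

Lemma hypot_ge0 x y : 0 <= hypot x y. Proof. exact: sqrtr_ge0. Qed.

Lemma measurable_hypot : measurable_fun setT (fun z : TR * TR => hypot z.1 z.2).
Proof.
apply: measurableT_comp.
  by apply: continuous_measurable_fun; exact: sqrt_continuous.
apply: measurable_funD.
- by apply: measurable_funX; exact: measurable_fst.
- by apply: measurable_funX; exact: measurable_snd.
Qed.

Variables (phi Phi : R -> R) (l : R).
Hypothesis phi_cont : continuous phi.
Hypothesis phi_ge0 : forall r : R, 0 <= r -> 0 <= phi r.
Hypothesis Phi_derive : forall r : R, 0 < r -> is_derive r 1 Phi (r * phi r).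
Hypothesis Phi0 : {for (0 : R), continuous Phi}.
Hypothesis Phi_lim : Phi r @[r --> +oo] --> l.

Let measurable_radial : measurable_fun setT
  (fun z : TR * TR => (phi (hypot z.1 z.2))%:E).
Proof.
apply/measurable_EFinP; apply: measurableT_comp; last exact: measurable_hypot.
exact: continuous_measurable_fun.
Qed.

Let continuous_radial x : continuous (fun y => phi (hypot x y)).
Proof.
move=> y; apply: (@continuous_comp _ _ _ (hypot x) phi).
  exact: continuous_hypot.
exact: phi_cont.
Qed.

Let half_line : [set x : R | 0 <= x] = `[0%R, +oo[%classic.
Proof. by apply/seteqP; split => x /=; rewrite in_itv /= andbT. Qed.

Let fold_even x : (\int[mu]_y (phi (hypot x y))%:E =
  2%:E * \int[mu]_(y in `[0%R, +oo[) (phi (hypot x y))%:E)%E.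
Proof.
rewrite ge0_symfun_integralT ?half_line //.
  by move=> y; rewrite phi_ge0 // hypot_ge0.
by move=> y; rewrite /= /hypot sqrrN.
Qed.

(** The substitution y = x t. The absolute values on the right keep the integrand nonnegative for
    every x, as Tonelli's theorem on the plane demands. *)
Let substitute_slope (x : R) : 0 < x ->
  (\int[mu]_(y in `[0%R, +oo[) (phi (hypot x y))%:E =
   \int[mu]_(t in `[0%R, +oo[) (`|x| * phi (`|x| * hypot 1 t))%:E)%E.
Proof.
move=> x0.
have dE : derive1 (fun t : R => x * t) = cst x.
  by apply/funext => t; rewrite derive1Ml // derive1_id mulr1.
have := @increasing_ge0_integration_by_substitutiony R (fun t => x * t)
  (fun y => phi (hypot x y)) 0.
rewrite mulr0 => ->.
- apply: eq_integral => t _; congr EFin.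
  rewrite dE /= gtr0_norm // mulrC; congr (_ * phi _).
  rewrite /hypot exprMn -{1}[x ^+ 2]mulr1 -mulrDr sqrtrM ?sqr_ge0 //.
  by rewrite expr1n sqrtr_sqr gtr0_norm.
- by move=> a b _ _ ab; rewrite ltr_pM2l.
- by rewrite dE => t _; exact: cvg_cst.
- by rewrite dE; exact: is_cvg_cst.
- by rewrite dE; exact: is_cvg_cst.
- split => //.
  by apply: cvg_at_right_filter; apply: cvgM => //; exact: cvg_cst.
- by apply: gt0_cvgMry => //; exact: cvg_id.
- by apply: continuous_subspaceT; exact: continuous_radial.
- by move=> y _; rewrite phi_ge0 // hypot_ge0.
Qed.

(** Along the ray of slope t the integrand x phi(c x), with c^2 = 1 + t^2, has the primitive Phi(c
    x) / c^2. *)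
Let radial_slice t : (\int[mu]_(x in `[0%R, +oo[) (`|x| * phi (`|x| * hypot 1 t))%:E =
  ((l - Phi 0) * (1 + t ^+ 2)^-1)%:E)%E.
Proof.
set c : R := hypot 1 t.
have c2 : c ^+ 2 = 1 + t ^+ 2 by rewrite sqr_sqrtr expr1n // addr_ge0 ?sqr_ge0.
have c0 : 0 < c.
  by rewrite sqrtr_gt0 expr1n ltr_wpDr // sqr_ge0.
pose F (x : R) : R := Phi (c * x) / c ^+ 2.
have dF (x : R) : 0 < x -> is_derive x 1 F (x * phi (x * c)).
  move=> x0; have -> : F = (c ^- 2) *: (Phi \o (fun y => c * y)).
    by apply/funext => y; rewrite /F /= mulrC.
  have d1 := Phi_derive (mulr_gt0 c0 x0).
  have d2 : is_derive x 1 (fun y => c * y) c.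
    by apply: is_derive_eq; rewrite scaler1.
  have d3 := is_derive1_comp d1 d2.
  apply: is_derive_eq; rewrite /GRing.scale /= (mulrC x c) /=.
  by field; rewrite gt_eqF.
transitivity (\int[mu]_(x in `[0%R, +oo[) (x * phi (x * c))%:E)%E.
  by apply: eq_integral => x; rewrite inE /= in_itv /= andbT => x0; rewrite ger0_norm.
rewrite (@ge0_continuous_FTC2y _ _ F _ (l / c ^+ 2)).
- by rewrite /F mulr0 -EFinB -mulrBl c2.
- by move=> x x0; rewrite mulr_ge0 // phi_ge0 // mulr_ge0 // ltW.
- apply: continuous_subspaceT => x; apply: cvgM => //.
  apply: (cvg_comp (fun x => x * c) phi); last exact: phi_cont.
  by apply: cvgM => //; exact: cvg_cst.
- apply: cvgM; last exact: cvg_cst.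
  by apply: cvg_comp Phi_lim; apply: gt0_cvgMry => //; exact: cvg_id.
- by move=> x x0; have [] := dF x x0.
- apply: cvg_at_right_filter; apply: cvgM; last exact: cvg_cst.
  have cz : c * x @[x --> (0 : R)] --> (0 : R).
    by rewrite -[X in _ --> X](mulr0 c); apply: cvgM => //; exact: cvg_cst.
  by rewrite mulr0; apply: (cvg_comp (fun x => c * x) Phi cz); exact: Phi0.
- move=> x; rewrite in_itv /= andbT => x0.
  by have := dF x x0 => d; rewrite derive1E derive_val.
Qed.

(** Symmetry gives four quadrants. In one of them, passing to slopes and exchanging the integrals
    leaves (l - Phi 0) times the integral of 1/(1 + t^2), which is pi/2. *)
Lemma radial_integral_ge0 : (\int[@leb2 R]_z (phi (hypot z.1 z.2))%:E =
  (2 * pi * (l - Phi 0))%:E)%E.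
Proof.
have pos0 : measurable (`[0%R, +oo[%classic : set TR) by exact: measurable_itv.
rewrite /leb2 fubini_tonelli1 //; last by move=> z; rewrite lee_fin phi_ge0 ?hypot_ge0.
rewrite /fubini_F.
under eq_integral do rewrite fold_even.
have f0 (z : TR * TR) : (0 <= (phi (hypot z.1 z.2))%:E)%E.
  by rewrite lee_fin phi_ge0 ?hypot_ge0.
rewrite ge0_integralZl //=; last 2 first.
- exact: (@measurable_fun_partial_integral _ _ TR TR R mu (fun z => (phi (hypot z.1 z.2))%:E)).
- by move=> x _; apply: integral_ge0 => y _; exact: (f0 (x, y)).
rewrite (@tonelli_on _ _ TR TR R mu mu (fun z => (phi (hypot z.1 z.2))%:E)) //=.
under eq_integral => y _.
  under eq_integral do rewrite hypotC.
  rewrite fold_even; over.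
rewrite ge0_integralZl //=; last 2 first.
- apply: measurable_funTS.
  exact: (@measurable_fun_partial_integral _ _ TR TR R mu (fun z => (phi (hypot z.1 z.2))%:E)).
- by move=> x _; apply: integral_ge0 => y _; exact: (f0 (x, y)).
(* The point x = 0 is dropped because the substitution y = x t degenerates there; it is restored
   before the exchange of integrals. *)
rewrite -integral_itv_obnd_cbnd; last first.
  apply: measurable_funTS.
  exact: (@measurable_fun_partial_integral _ _ TR TR R mu (fun z => (phi (hypot z.1 z.2))%:E)).
pose g (z : TR * TR) := (`|z.1| * phi (`|z.1| * hypot 1 z.2))%:E.
have mg : measurable_fun setT g.
  have m1 : measurable_fun setT (fun z : TR * TR => `|z.1|).
    by apply: measurableT_comp => //; exact: measurable_fst.
  apply/measurable_EFinP; apply: measurable_funM => //.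
  apply: measurableT_comp; first exact: continuous_measurable_fun.
  apply: measurable_funM => //.
  apply: measurableT_comp; last exact: measurable_snd.
  by apply: continuous_measurable_fun; exact: continuous_hypot.
have g0 z : (0 <= g z)%E by rewrite lee_fin mulr_ge0 // phi_ge0 // mulr_ge0 ?hypot_ge0.
transitivity (2%:E * (2%:E * \int[mu]_(x in `]0%R, +oo[) \int[mu]_(t in `[0%R, +oo[) g (x, t)))%E.
  congr (_ * (_ * _))%E; apply: eq_integral => x; rewrite inE /= in_itv /= andbT => x0.
  exact: substitute_slope.
rewrite integral_itv_obnd_cbnd; last first.
  by apply: measurable_funTS; exact: measurable_fun_partial_integral.
rewrite tonelli_on //.
under eq_integral do rewrite radial_slice EFinM.
(* Read off the slice t = 0, whose value is l - Phi 0 and whose integrand is nonnegative. *)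
have lPhi : 0 <= l - Phi 0.
  have : (0 <= \int[mu]_(x in `[0%R, +oo[) g (x, 0%R))%E by apply: integral_ge0.
  by rewrite radial_slice lee_fin expr0n addr0 invr1 mulr1.
rewrite ge0_integralZl_EFin //=; last 2 first.
- by move=> t _; rewrite lee_fin invr_ge0 addr_ge0 ?sqr_ge0.
- apply/measurable_EFinP/measurable_funTS; apply: continuous_measurable_fun.
  exact: continuous_oneDsqrV.
have -> : (\int[mu]_(x in `[0%R, +oo[) ((1 + x ^+ 2)^-1)%:E)%E = (pi / 2)%:E.
  exact: integral0y_oneDsqr.
by rewrite -!EFinM; congr EFin; field.
Qed.

Lemma radial_integrable_ge0 : (@leb2 R).-integrable setT
  (EFin \o (fun z => phi (hypot z.1 z.2))).
Proof.
apply/integrableP; split; first exact: measurable_radial.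
under eq_integral => z _.
  rewrite gee0_abs; last by rewrite lee_fin phi_ge0 ?hypot_ge0.
  over.
by rewrite [ltLHS]radial_integral_ge0 ltry.
Qed.

End Radial.

Section RadialSigned.
Variable R : realType.
Variables (phi Phi : R -> R) (l C : R).
Hypothesis phi_cont : continuous phi.
Hypothesis phi_bound : forall r : R, 0 <= r -> `|phi r| <= C * (1 + `|r|)^-1 ^+ 3.
Hypothesis Phi_derive : forall r : R, 0 < r -> is_derive r 1 Phi (r * phi r).
Hypothesis Phi0 : {for (0 : R), continuous Phi}.
Hypothesis Phi_lim : Phi r @[r --> +oo] --> l.

Let h (r : R) := C * (1 + `|r|)^-1 ^+ 3.
(** A primitive of r h(r), from the decomposition r / (1 + r)^3 = 1 / (1 + r)^2 - 1 / (1 + r)^3. *)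
Let Hh (r : R) := C * (2^-1 * (1 + r)^-1 ^+ 2 - (1 + r)^-1).

Let oneD_gt0 (r : R) : 0 < 1 + `|r|.
Proof. by rewrite ltr_wpDr. Qed.

Let C_ge0 : 0 <= C.
Proof.
have := le_trans (normr_ge0 _) (phi_bound (lexx 0)).
by rewrite normr0 addr0 invr1 expr1n mulr1.
Qed.

Let h_cont : continuous h.
Proof.
move=> r; apply: cvgM; first exact: cvg_cst.
apply: (cvg_comp (fun r : R => (1 + `|r|)^-1) (fun z => z ^+ 3)); last exact: exprn_continuous.
apply: cvgV; first by rewrite gt_eqF.
by apply: cvgD; [exact: cvg_cst|exact: norm_continuous].
Qed.

Let h_ge0 r : 0 <= r -> 0 <= h r.
Proof. by move=> r0; rewrite mulr_ge0 // exprn_ge0 // invr_ge0 ltW. Qed.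

Let Hh_derive (r : R) : 0 < r -> is_derive r 1 Hh (r * h r).
Proof.
move=> r0.
have r1 : 1 + r != 0 by rewrite gt_eqF // addr_gt0.
have d0 : is_derive r 1 (fun r : R => 1 + r) 1.
  by apply: is_derive_eq; rewrite add0r mulr1.
have d1 : is_derive r 1 (fun r : R => (1 + r)^-1) (- (1 + r)^-1 ^+ 2).
  have := @is_deriveV _ (fun r : R => 1 + r) r 1 1 r1 d0.
  by rewrite /GRing.scale /= mulr1 -exprVn.
have d2 : is_derive r 1 (fun r : R => (1 + r)^-1 ^+ 2) (- 2 * (1 + r)^-1 ^+ 3).
  apply: (@is_derive_eq _ _ _ ((fun r : R => (1 + r)^-1) ^+ 2)).
  by rewrite /GRing.scale /=; ring.
have -> : Hh = C *: (2^-1 *: (fun r : R => (1 + r)^-1 ^+ 2) - (fun r : R => (1 + r)^-1)).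
  by apply/funext.
apply: is_derive_eq; rewrite /GRing.scale /= /h gtr0_norm //.
by field.
Qed.

Let Hh_lim : Hh r @[r --> +oo] --> (0 : R).
Proof.
have v0 : (1 + r)^-1 @[r --> +oo] --> (0 : R).
  have pos : \forall r \near (pinfty_nbhs R), 0 < 1 + r.
    by near=> r; rewrite addr_gt0 //; near: r; exact: nbhs_pinfty_gt.
  apply/(gtr0_cvgV0 pos).
  apply/cvgryPge => A; near=> r.
  apply: (@le_trans _ _ r); last by rewrite lerDr.
  by near: r; apply: nbhs_pinfty_ge; exact: num_real.
rewrite (_ : 0 = C * (2^-1 * 0 ^+ 2 - 0)); last by rewrite expr0n mulr0 subr0 mulr0.
apply: cvgM; first exact: cvg_cst.
apply: cvgB => //; apply: cvgM; first exact: cvg_cst.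
by apply: (cvg_comp (fun r : R => (1 + r)^-1) (fun z => z ^+ 2) v0); exact: exprn_continuous.
Unshelve. all: by end_near. Qed.

Let Hh0 : {for (0 : R), continuous Hh}.
Proof.
have v0 : (1 + r)^-1 @[r --> (0 : R)] --> ((1 + 0)^-1 : R).
  apply: cvgV; first by rewrite addr0.
  by apply: cvgD => //; exact: cvg_cst.
apply: cvgM; first exact: cvg_cst.
apply: cvgB => //; apply: cvgM; first exact: cvg_cst.
by apply: (cvg_comp (fun r : R => (1 + r)^-1) (fun z => z ^+ 2) v0); exact: exprn_continuous.
Qed.

(** Writing phi = (phi + h) - h with the majorant h reduces the signed case to two nonnegative
    integrable functions. *)
Lemma radial_integral :
  \int[@leb2 R]_z (phi (hypot z.1 z.2)) = 2 * pi * (l - Phi 0).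
Proof.
pose TR : measurableType _ := measurableTypeR R.
have I1 := radial_integral_ge0 h_cont h_ge0 Hh_derive Hh0 Hh_lim.
have ph_cont : continuous (fun r => phi r + h r).
  by move=> r; apply: cvgD; [exact: phi_cont|exact: h_cont].
have ph_ge0 r : 0 <= r -> 0 <= phi r + h r.
  by move=> /phi_bound; rewrite ler_norml => /andP[+ _]; rewrite -subr_ge0 opprK.
pose PH r := Phi r + Hh r.
have PH_derive (r : R) : 0 < r -> is_derive r 1 PH (r * (phi r + h r)).
  move=> r0; have d1 := Phi_derive r0; have d2 := Hh_derive r0.
  by apply: is_derive_eq; rewrite mulrDr.
have PH0 : {for (0 : R), continuous PH} by apply: cvgD.
have PH_lim : PH r @[r --> +oo] --> l + 0 by apply: cvgD.
have I2 := radial_integral_ge0 ph_cont ph_ge0 PH_derive PH0 PH_lim.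
have J1 := radial_integrable_ge0 h_cont h_ge0 Hh_derive Hh0 Hh_lim.
have J2 := radial_integrable_ge0 ph_cont ph_ge0 PH_derive PH0 PH_lim.
transitivity (\int[@leb2 R]_z ((phi (hypot z.1 z.2) + h (hypot z.1 z.2))
   - h (hypot z.1 z.2))).
  by apply: eq_Rintegral => z _; rewrite addrK.
rewrite RintegralB // /Rintegral I1 I2 /= /PH.
by ring.
Qed.

End RadialSigned.

(** * Invariance properties of the sign and trace identities for the curvature *)

Section SignTransport.
Variables (R : realType) (n : nat).
Implicit Types (H S A B X U : 'M[R[i]]_n).
Local Notation adj := (@adjmx R _).

Lemma is_sign_unique H S S' : selfadjoint H -> is_sign H S -> is_sign H S' -> S = S'.
Proof.
move=> hH hS hS'; have := negproj_sign hH hS; rewrite (negproj_sign hH hS').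
move/(congr1 (fun M => 1%:M - (2%:C : R[i]) *: M)); rewrite !scalerA -rmorphM mulfV ?pnatr_eq0 //.
by rewrite !scale1r !opprB !(addrC 1%:M) !subrK.
Qed.

Lemma is_sign_scale H S (c : R) : 0 < c -> is_sign H S -> is_sign (c%:C *: H) S.
Proof.
move=> c0 [hS SS SH [g g0 co]]; split => //.
  by rewrite -scalemxAr -scalemxAl SH.
exists (c * g); first exact: mulr_gt0.
move=> X; rewrite -scalemxAr -scalemxAr -scalemxAl mxtraceZ Re_mulC -mulrA.
by rewrite ler_pM2l.
Qed.

Lemma is_sign_conj H S U : adj U *m U = 1%:M -> U *m adj U = 1%:M ->
  is_sign H S -> is_sign (U *m H *m adj U) (U *m S *m adj U).
Proof.
move=> U1 U2 [hS SS SH [g g0 co]].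
have e M N : U *m M *m adj U *m (U *m N *m adj U) = U *m (M *m N) *m adj U.
  by rewrite !mulmxA -(mulmxA (U *m M)) U1 mulmx1.
split.
- by rewrite !adjmxM adjmxK hS !mulmxA.
- by rewrite e SS mulmx1.
- by rewrite !e SH.
exists g => // X; rewrite e.
have := co (adj U *m X).
have -> : frob (adj U *m X) = frob X.
  by rewrite /frob adjmxM adjmxK mulmxA -(mulmxA (adj X)) U2 mulmx1.
by rewrite adjmxM adjmxK !mulmxA.
Qed.

Lemma sign_deriv_conj H S A X U : adj U *m U = 1%:M -> sign_deriv H S A X ->
  sign_deriv (U *m H *m adj U) (U *m S *m adj U) (U *m A *m adj U) (U *m X *m adj U).
Proof.
move=> U1 h.
have e M N : U *m M *m adj U *m (U *m N *m adj U) = U *m (M *m N) *m adj U.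
  by rewrite !mulmxA -(mulmxA (U *m M)) U1 mulmx1.
rewrite /sign_deriv !e -cmulmxDl -cmulmxDr h.
by rewrite cmulmxBr cmulmxBl.
Qed.

Lemma sign_deriv_lin H S A B X Y (a b : R[i]) :
  sign_deriv H S A X -> sign_deriv H S B Y ->
  sign_deriv H S (a *: A + b *: B) (a *: X + b *: Y).
Proof.
move=> h1 h2; rewrite /sign_deriv.
transitivity (a *: (S *m H *m X + X *m (S *m H)) + b *: (S *m H *m Y + Y *m (S *m H))).
  by mx_additive.
by rewrite h1 h2; mx_additive.
Qed.

Lemma sign_deriv_scale H S A X (c : R) : 
  sign_deriv H S A X -> sign_deriv (c%:C *: H) S (c%:C *: A) X.
Proof.
move=> h; rewrite /sign_deriv.
transitivity (c%:C *: (S *m H *m X + X *m (S *m H))); first by mx_additive.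
by rewrite h; mx_additive.
Qed.

(** Euler's relation: the sign is homogeneous of degree zero. *)
Lemma sign_deriv_self H S : is_sign H S -> sign_deriv H S H 0.
Proof.
move=> [_ SS SH _]; rewrite /sign_deriv mulmx0 mul0mx addr0.
by rewrite SH -mulmxA SS mulmx1 subrr.
Qed.

(* The infinitesimal form of conjugation covariance. *)
Lemma sign_deriv_comm H S L : is_sign H S ->
  sign_deriv H S (L *m H - H *m L) (L *m S - S *m L).
Proof.
move=> [_ SS SH _]; rewrite /sign_deriv.
have e1 M : S *m H *m (M *m S) = H *m S *m M *m S by rewrite SH !mulmxA.
have e2 : S *m H *m (S *m L) = H *m L by rewrite SH -!mulmxA (mulmxA S) SS mul1mx.
have e3 : L *m S *m (S *m H) = L *m H by rewrite -!mulmxA (mulmxA S S) SS mul1mx.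
rewrite cmulmxBr cmulmxBl e1 e2 e3.
have -> : S *m (L *m H - H *m L) *m S = S *m L *m (S *m H) - H *m S *m L *m S.
  by rewrite cmulmxBr cmulmxBl !cmulmxA -(mulmxA (S *m L) H S) -SH !cmulmxA SH.
by mx_additive.
Qed.

Lemma is_sign_involution A : selfadjoint A -> A *m A = 1%:M -> is_sign A A.
Proof.
move=> hA AA; split => //; exists 1 => // X.
by rewrite AA mulmx1 mul1r.
Qed.

(** Since X anticommutes with the involution S, each of the four terms of the expansion has trace
    tr(L X). *)
Lemma trace_sign_commutator S X L : S *m S = 1%:M -> S *m X = - (X *m S) ->
  \tr (S *m (X *m (L *m S - S *m L) - (L *m S - S *m L) *m X)) = 4 * \tr (L *m X).
Proof.
move=> SS SX.
have SXS : S *m X *m S = - X by rewrite SX mulNmx -mulmxA SS mulmx1.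
have -> : S *m (X *m (L *m S - S *m L) - (L *m S - S *m L) *m X) =
   S *m X *m L *m S - S *m X *m S *m L - S *m L *m S *m X + S *m S *m L *m X.
  by mx_additive.
rewrite SXS SS mul1mx raddfD raddfB raddfB /=.
have -> : \tr (S *m X *m L *m S) = \tr (L *m X).
  by rewrite mxtrace_mulC !mulmxA SS mul1mx mxtrace_mulC.
have -> : \tr (S *m L *m S *m X) = - \tr (L *m X).
  by rewrite -!mulmxA mxtrace_mulC -!mulmxA (mulmxA S X) SXS mulmxN raddfN.
rewrite mulNmx raddfN /= [\tr (X *m L)]mxtrace_mulC.
by ring.
Qed.

(** The three factors 1/2 come from Pi = (1 - S)/2 and its two derivatives; the identity part of Pi
    contributes the trace of a commutator, which is zero. *)
Lemma trace_half_curvature S X Y : 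
  \tr (2^-1%:C *: (1%:M - S) *m ((- 2^-1)%:C *: X *m ((- 2^-1)%:C *: Y) -
    (- 2^-1)%:C *: Y *m ((- 2^-1)%:C *: X))) =
  - ((8^-1)%:C * \tr (S *m (X *m Y - Y *m X))).
Proof.
have -> : 2^-1%:C *: (1%:M - S) *m ((- 2^-1)%:C *: X *m ((- 2^-1)%:C *: Y) -
    (- 2^-1)%:C *: Y *m ((- 2^-1)%:C *: X)) =
    (8^-1)%:C *: (X *m Y - Y *m X - S *m (X *m Y - Y *m X)).
  rewrite cmulmxZl cmulmxBl mul1mx.
  have -> : (8^-1)%:C = 2^-1%:C * (- 2^-1)%:C * (- 2^-1)%:C :> R[i].
    by rewrite -!rmorphM; congr _%:C; field.
  by mx_additive.
have tc : \tr (X *m Y - Y *m X) = 0 by rewrite raddfB /= mxtrace_mulC subrr.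
by rewrite mxtraceZ raddfB /= tc sub0r mulrN.
Qed.

(** A commutator of selfadjoint matrices is antiselfadjoint, so the trace is imaginary and the Chern
    density, with its prefactor i, is real. *)
Lemma Re_trace_curvature S X Y : selfadjoint S -> selfadjoint X -> selfadjoint Y ->
  complex.Re (\tr (S *m (X *m Y - Y *m X))) = 0.
Proof.
move=> hS hX hY.
have : (\tr (S *m (X *m Y - Y *m X)))^* = - \tr (S *m (X *m Y - Y *m X)).
  rewrite -mxtrace_adj adjmxM adjmxB !adjmxM hS hX hY mxtrace_mulC.
  by rewrite -[Y *m X - _]opprB mulmxN raddfN.
by case: (\tr _) => a b /(congr1 (@complex.Re R)) /= ha; lra.
Qed.

End SignTransport.

(** * Chern number of a rotation covariant family *)

Lemma bounded_unit_interval (R : realType) (f : R -> R) : continuous f ->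
  exists2 M : R, 0 <= M & forall x, 0 <= x -> x <= 1 -> `|f x| <= M.
Proof.
move=> cf.
have [|c _ hc] := @EVT_max R (fun x => `|f x|) 0 1 ler01.
  apply: continuous_subspaceT => x.
  by apply: (cvg_comp f Num.norm); [exact: cf|exact: norm_continuous].
by exists `|f c| => // x x0 x1; apply: hc; rewrite in_itv /= x0.
Qed.

Section RotationFamily.
Variables (R : realType) (n : nat).
Variables B Ax Ay L : 'M[R[i]]_n.
Local Notation adj := (@adjmx R _).

Definition planar (x y : R) : 'M[R[i]]_n := B + x%:C *: Ax + y%:C *: Ay.
Local Notation H := planar.

Hypothesis hB : selfadjoint B.
Hypothesis hAx : selfadjoint Ax.
Hypothesis hAy : selfadjoint Ay.
Hypothesis AxAx : Ax *m Ax = 1%:M.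
Hypothesis H_unit : forall x y, H x y \in unitmx.
(** Two forms of rotation covariance: the infinitesimal one gives the angular derivative of the
    sign, and the finite one, [H_rot], carries the radial derivative back to the positive
    half-axis. *)
Hypothesis H_comm : forall x y,
  x%:C *: Ay - y%:C *: Ax = 'i *: (L *m H x y - H x y *m L).
Hypothesis H_rot : forall x y, hypot x y != 0 -> exists U : 'M[R[i]]_n,
  [/\ adj U *m U = 1%:M, U *m adj U = 1%:M, U *m L = L *m U &
   forall t, U *m H t 0 *m adj U = H (t * (x / hypot x y)) (t * (y / hypot x y))].

Let hH x y : selfadjoint (H x y).
Proof. by rewrite /selfadjoint /H !adjmxD !adjmxZ hB hAx hAy. Qed.

Definition sgn_at x y : 'M[R[i]]_n := 1%:M - 2%:C *: negproj (H x y).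
Local Notation S := sgn_at.

Lemma negproj_sgn_at x y : negproj (H x y) = 2^-1%:C *: (1%:M - S x y).
Proof.
rewrite /S opprB addrC subrK scalerA -rmorphM mulVf ?pnatr_eq0 //.
by rewrite scale1r.
Qed.

Lemma is_sign_at x y : is_sign (H x y) (S x y).
Proof.
have [S0 hS0] := exists_sign (hH x y) (H_unit x y).
rewrite /S (negproj_sign (hH x y) hS0) scalerA -rmorphM mulfV ?pnatr_eq0 //.
by rewrite scale1r opprB addrC subrK.
Qed.

Let X x y := projT1 (cid (exists_sign_deriv Ax (is_sign_at x y))).
Let Y x y := projT1 (cid (exists_sign_deriv Ay (is_sign_at x y))).
Let XP x y : sign_deriv (H x y) (S x y) Ax (X x y).
Proof. by rewrite /X; case: cid. Qed.
Let YP x y : sign_deriv (H x y) (S x y) Ay (Y x y).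
Proof. by rewrite /Y; case: cid. Qed.

Let F x y := negproj (H x y).

Let F_entry x y p q : F x y p q = 2^-1%:C * ((p == q)%:R - S x y p q).
Proof. by rewrite /F negproj_sgn_at; move: (S x y) => M; rewrite !mxE. Qed.

Let dkxE x y : dkx F x y = (- 2^-1)%:C *: X x y.
Proof.
have HA t : H t y = H x y + (t - x)%:C *: Ax.
  by rewrite /H rmorphB /=; apply/matrixP => i j; rewrite !mxE; ring.
apply/matrixP => p q; rewrite !mxE.
have hs t := is_sign_at t y.
have dR := is_derive_Re_sign hs HA (XP x y) p q.
have dI := is_derive_Im_sign hs HA (XP x y) p q.
have -> : (fun t => complex.Re (F t y p q)) =
   2^-1 *: (cst ((p == q)%:R) - (fun t => complex.Re (S t y p q))).
  apply/funext => t; rewrite F_entry Re_mulC ReB.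
  by congr (_ * (_ - _)); case: eqP.
have -> : (fun t => complex.Im (F t y p q)) =
   2^-1 *: (cst 0 - (fun t => complex.Im (S t y p q))).
  apply/funext => t; rewrite F_entry Im_mulC ImB.
  by congr (_ * (_ - _)); case: eqP.
rewrite !derive1E !derive_val !sub0r /GRing.scale /=.
case: (X x y p q) => a b; apply/eqP; rewrite eq_complex /=.
by apply/andP; split; apply/eqP; lra.
Qed.

Let dkyE x y : dky F x y = (- 2^-1)%:C *: Y x y.
Proof.
have HA t : H x t = H x y + (t - y)%:C *: Ay.
  by rewrite /H rmorphB /=; apply/matrixP => i j; rewrite !mxE; ring.
apply/matrixP => p q; rewrite !mxE.
have hs t := is_sign_at x t.
have dR := is_derive_Re_sign hs HA (YP x y) p q.
have dI := is_derive_Im_sign hs HA (YP x y) p q.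
have -> : (fun t => complex.Re (F x t p q)) =
   2^-1 *: (cst ((p == q)%:R) - (fun t => complex.Re (S x t p q))).
  apply/funext => t; rewrite F_entry Re_mulC ReB.
  by congr (_ * (_ - _)); case: eqP.
have -> : (fun t => complex.Im (F x t p q)) =
   2^-1 *: (cst 0 - (fun t => complex.Im (S x t p q))).
  apply/funext => t; rewrite F_entry Im_mulC ImB.
  by congr (_ * (_ - _)); case: eqP.
rewrite !derive1E !derive_val !sub0r /GRing.scale /=.
case: (Y x y p q) => a b; apply/eqP; rewrite eq_complex /=.
by apply/andP; split; apply/eqP; lra.
Qed.

Let curv x y := S x y *m (X x y *m Y x y - Y x y *m X x y).

Let densityE x y : chern_density F (x, y) =
  (- (16 * pi)^-1)%:C * ('i * \tr (curv x y)).
Proof.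
rewrite /chern_density /= dkxE dkyE /F negproj_sgn_at.
rewrite trace_half_curvature -/(curv x y).
have pi0 : pi != 0 :> R by rewrite gt_eqF ?pi_gt0.
have -> : (- (16 * pi)^-1)%:C = - ((8^-1)%:C * (2 * pi)^-1%:C) :> R[i].
  by rewrite -rmorphM -rmorphN; congr _%:C; move: (pi : R) pi0 => c c0; field.
rewrite -[((2 * pi)%:C)^-1](fmorphV (real_complex R)) /=.
move: (\tr _) => z; ring.
Qed.

(* In polar coordinates: the angular derivative of [S] is the commutator with
   the generator [L], which turns the curvature into a radial derivative. *)
Let trace_curv x y : (x ^+ 2 + y ^+ 2)%:C * \tr (curv x y) =
  4 * ('i * \tr (L *m (x%:C *: X x y + y%:C *: Y x y))).
Proof.
have hs := is_sign_at x y.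
pose Z := x%:C *: X x y + y%:C *: Y x y.
have hZ := sign_deriv_lin x%:C y%:C (XP x y) (YP x y).
have ang : x%:C *: Y x y - y%:C *: X x y = 'i *: (L *m S x y - S x y *m L).
  have h1 := sign_deriv_lin x%:C (- y%:C) (YP x y) (XP x y).
  have h2 := sign_deriv_lin 'i 0 (sign_deriv_comm L hs) (sign_deriv_comm L hs).
  move: h1 h2; rewrite !scaleNr !scale0r !addr0 H_comm => h1 h2.
  exact: sign_deriv_unique hs h1 h2.
have [_ SS _ _] := hs.
have := trace_sign_commutator L SS (sign_deriv_anticomm hs hZ).
rewrite -/Z => h.
rewrite mulrCA -h -mxtraceZ -mxtraceZ; congr (\tr _).
rewrite /curv -!cmulmxZr; congr (_ *m _).
have -> : 'i *: (Z *m (L *m S x y - S x y *m L) - (L *m S x y - S x y *m L) *m Z) =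
  Z *m ('i *: (L *m S x y - S x y *m L)) - ('i *: (L *m S x y - S x y *m L)) *m Z.
  by rewrite scalerBr cmulmxZr cmulmxZl.
rewrite -ang /Z rmorphD !rmorphXn /=.
by move: (X x y) (Y x y) => a b; mx_additive.
Qed.

(** Conjugation by U carries the radial derivative at (r, 0) to the one at (x, y), and U commutes
    with L, so the trace is unchanged. *)
Let trace_radial x y : hypot x y != 0 ->
  \tr (L *m (x%:C *: X x y + y%:C *: Y x y)) =
  (hypot x y)%:C * \tr (L *m X (hypot x y) 0).
Proof.
set r := hypot x y => r0.
have [U [U1 U2 UL UH]] := H_rot r0.
have UHr : U *m H r 0 *m adj U = H x y.
  by rewrite UH mulrC divfK // [r * _]mulrC divfK.
have rot_Ax : U *m (r%:C *: Ax) *m adj U = x%:C *: Ax + y%:C *: Ay.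
  (* [H_rot] speaks of values of H only, so the direction is expressed as a difference of two
     values. *)
  have -> : r%:C *: Ax = H r 0 - H 0 0.
    by rewrite /H; apply/matrixP => i j; rewrite !mxE; ring.
  have U0 : U *m H 0 0 *m adj U = H 0 0 by rewrite UH !mul0r.
  rewrite cmulmxBr cmulmxBl UHr U0 /H.
  by apply/matrixP => i j; rewrite !mxE; ring.
have sU : U *m S r 0 *m adj U = S x y.
  apply: (is_sign_unique (hH x y)); last exact: is_sign_at.
  by rewrite -UHr; apply: is_sign_conj => //; exact: is_sign_at.
have d1 : sign_deriv (H x y) (S x y) (x%:C *: Ax + y%:C *: Ay)
    (U *m (r%:C *: X r 0) *m adj U).
  rewrite -UHr -sU -rot_Ax; apply: sign_deriv_conj => //.
  have := sign_deriv_lin r%:C 0 (XP r 0) (XP r 0).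
  by rewrite !scale0r !addr0.
have d2 := sign_deriv_lin x%:C y%:C (XP x y) (YP x y).
rewrite (sign_deriv_unique (is_sign_at x y) d2 d1) -mxtraceZ.
rewrite !cmulmxA -UL -!mulmxA mxtrace_mulC -!mulmxA U1 mulmx1.
by rewrite cmulmxZr.
Qed.

Let pi0 : pi != 0 :> R. Proof. by rewrite gt_eqF ?pi_gt0. Qed.

(** The factor 4 i of [trace_curv] against -i / (16 pi) leaves 1 / (4 pi). *)
Let density_trace x y : hypot x y != 0 ->
  (hypot x y ^+ 2)%:C * chern_density F (x, y) =
  (4 * pi)^-1%:C * ((hypot x y)%:C * \tr (L *m X (hypot x y) 0)).
Proof.
move=> r0; rewrite densityE sqr_sqrtr ?addr_ge0 ?sqr_ge0 //.
have e := trace_curv x y; rewrite (trace_radial r0) in e.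
move: (\tr (L *m _)) (\tr (curv x y)) e => z c e.
have -> : (- (16 * pi)^-1)%:C = - ((4 * pi)^-1%:C * (4^-1)%:C) :> R[i].
  by rewrite -rmorphM -rmorphN; congr _%:C; move: (pi : R) pi0 => q q0; field.
have i2 : 'i * 'i = -1 :> R[i] by rewrite -expr2 sqr_i.
have q4 : (4^-1)%:C * 4 = 1 :> R[i].
  by rewrite -(rmorph_nat (real_complex R) 4) -rmorphM mulVf ?pnatr_eq0.
move: ((4 * pi)^-1%:C) ((4^-1)%:C) ((x ^+ 2 + y ^+ 2)%:C) ((hypot x y)%:C) q4 e
  => q s p r q4 e.
transitivity (- (q * s * 'i * (p * c))); first by ring.
rewrite e; transitivity (- (q * (s * 4) * ('i * 'i) * (r * z))); first by ring.
by rewrite q4 i2; ring.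
Qed.

Let phi r := complex.Re (chern_density F (r, 0)).

Let hypot_pos (r : R) : 0 < r -> hypot r 0 = r.
Proof. by move=> r0; rewrite /hypot expr0n addr0 sqrtr_sqr gtr0_norm. Qed.

Let density_radial x y : complex.Re (chern_density F (x, y)) = phi (hypot x y).
Proof.
have [r0|r0] := eqVneq (hypot x y) 0.
  move/eqP: (r0); rewrite sqrtr_eq0 => h.
  have [x0 y0] : x = 0 /\ y = 0.
    have := sqr_ge0 x; have := sqr_ge0 y => hy hx.
    by split; apply/eqP; rewrite -sqrf_eq0 eq_le ?hx ?hy andbT; lra.
  by rewrite x0 y0 /phi /hypot expr0n addr0 sqrtr0.
have rp : 0 < hypot x y by rewrite lt_def r0 hypot_ge0.
have e1 := density_trace r0.
have e2 := @density_trace (hypot x y) 0; rewrite (hypot_pos rp) in e2.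
have {}e2 := e2 r0; rewrite -e1 in e2.
have nz : (hypot x y ^+ 2)%:C != 0 by rewrite fmorph_eq0 sqrf_eq0.
by rewrite /phi (mulfI nz e2).
Qed.

Let density_Im x y : complex.Im (chern_density F (x, y)) = 0.
Proof.
rewrite densityE Im_mulC.
have hs := is_sign_at x y; have [hS _ _ _] := hs.
have hX := sign_deriv_herm (hH x y) hAx hs (XP x y).
have hY := sign_deriv_herm (hH x y) hAy hs (YP x y).
have := Re_trace_curvature hS hX hY; rewrite -/(curv x y).
by case: (\tr _) => a b /= ->; rewrite mul0r mul1r addr0 mulr0.
Qed.

Let lip_axis t : lipschitz_at (fun t => H t 0) t.
Proof.
have -> : (fun t => H t 0) = (fun t => B + t%:C *: Ax).
  by apply/funext => u; rewrite /H scale0r addr0.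
exact: lipschitz_affine.
Qed.

Let phi_cont : continuous phi.
Proof.
move=> t.
have hs u := is_sign_at u 0.
have lX := lipschitz_sign_deriv hs (lip_axis t) (fun u => XP u 0).
have lY := lipschitz_sign_deriv hs (lip_axis t) (fun u => YP u 0).
have lS := lipschitz_sign hs (lip_axis t).
have := @continuous_Re_trace R n
  (fun u => (((- (16 * pi)^-1)%:C * 'i)%:M : 'M[R[i]]_n) *m curv u 0) t.
have -> : (fun u => complex.Re (\tr ((((- (16 * pi)^-1)%:C * 'i)%:M : 'M[R[i]]_n) *m curv u 0))) = phi.
  by apply/funext => u; rewrite mul_scalar_mx mxtraceZ -mulrA /phi densityE.
apply; apply: lipschitzM; first exact: lipschitz_cst.
apply: lipschitzM => //; apply: lipschitzB; exact: lipschitzM.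
Qed.

Let r_phi (r : R) : 0 < r -> r * phi r = (4 * pi)^-1 * complex.Re (\tr (L *m X r 0)).
Proof.
move=> r0; have rn : r != 0 by rewrite gt_eqF.
have := @density_trace r 0; rewrite (hypot_pos r0) => /(_ rn).
move/(congr1 (@complex.Re R)); rewrite !Re_mulC -/(phi r) mulrCA expr2 -mulrA.
by move/(mulfI rn).
Qed.

Let Phi r := (4 * pi)^-1 * complex.Re (\tr (L *m S r 0)).

Let Phi_derive (r : R) : 0 < r -> is_derive r 1 Phi (r * phi r).
Proof.
move=> r0.
have HA t : H t 0 = H r 0 + (t - r)%:C *: Ax.
  by rewrite /H rmorphB /=; apply/matrixP => i j; rewrite !mxE; ring.
have hs u := is_sign_at u 0.
have d := is_derive_Re_trace_sign hs HA (XP r 0) L.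
have -> : Phi = (4 * pi)^-1 *: (fun t => complex.Re (\tr (L *m S t 0))) by apply/funext.
by apply: is_derive_eq; rewrite r_phi.
Qed.

Let Phi0 : {for (0 : R), continuous Phi}.
Proof.
have hs u := is_sign_at u 0.
have := @continuous_Re_trace R n (fun u => L *m S u 0) 0.
move=> h; apply: cvgM; first exact: cvg_cst.
apply: h; apply: lipschitzM; first exact: lipschitz_cst.
exact: (lipschitz_sign hs (lip_axis 0)).
Qed.

(** The family seen from infinity, e = 1/r. It is affine in e, so the perturbation results apply at
    e = 0, where its value is the involution Ax. *)
Let Hi (e : R) := Ax + e%:C *: B.

Let HiE (r : R) : 0 < r -> Hi r^-1 = r^-1%:C *: H r 0.
Proof.
move=> r0; rewrite /Hi /H scale0r addr0 scalerDr scalerA -rmorphM mulVf ?gt_eqF //.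
by rewrite scale1r addrC.
Qed.

Let hHi e : selfadjoint (Hi e).
Proof. by rewrite /selfadjoint adjmxD adjmxZ hAx hB. Qed.

Let Hi_unit e : Hi e \in unitmx.
Proof.
have [->|e0] := eqVneq e 0.
  by rewrite /Hi scale0r addr0; case/mulmx1_unit: AxAx.
have -> : Hi e = e%:C *: H e^-1 0.
  rewrite /Hi /H scale0r addr0 scalerDr scalerA -rmorphM mulfV //.
  by rewrite scale1r addrC.
by rewrite unitmxZ ?H_unit // unitfE fmorph_eq0.
Qed.

Let Si e := projT1 (cid (exists_sign (hHi e) (Hi_unit e))).
Let SiP e : is_sign (Hi e) (Si e).
Proof. by rewrite /Si; case: cid. Qed.
Let Xi e := projT1 (cid (exists_sign_deriv B (SiP e))).
Let XiP e : sign_deriv (Hi e) (Si e) B (Xi e).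
Proof. by rewrite /Xi; case: cid. Qed.

Let SiE (r : R) : 0 < r -> Si r^-1 = S r 0.
Proof.
move=> r0; apply: (is_sign_unique (hHi r^-1) (SiP _)).
by rewrite HiE //; apply: is_sign_scale; rewrite ?invr_gt0 //; exact: is_sign_at.
Qed.

(** The chain rule for e = 1/r, by linearity: Ax / r is [Hi] / r minus B / r^2, and the direction
    [Hi] itself contributes zero. *)
Let XiE (r : R) : 0 < r -> X r 0 = (- r^-1 ^+ 2)%:C *: Xi r^-1.
Proof.
move=> r0.
have hs : is_sign (Hi r^-1) (S r 0) by rewrite -SiE.
have d1 : sign_deriv (Hi r^-1) (S r 0) (r^-1%:C *: Ax) (X r 0).
  by rewrite HiE //; apply: sign_deriv_scale.
have := XiP r^-1; rewrite SiE // => d0.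
have := sign_deriv_lin r^-1%:C (- r^-1 ^+ 2)%:C (sign_deriv_self hs) d0.
rewrite scaler0 add0r => d2.
apply: (sign_deriv_unique hs d1); move: d2; congr (sign_deriv _ _ _ _).
rewrite /Hi scalerDr scalerA -rmorphM -expr2 -addrA -scalerDl -rmorphD.
by rewrite subrr scale0r addr0.
Qed.

Let lip_inf t : lipschitz_at Hi t.
Proof. exact: lipschitz_affine. Qed.

Let Phi_lim : Phi r @[r --> +oo] --> (4 * pi)^-1 * complex.Re (\tr (L *m Ax)).
Proof.
have Si0 : Si 0 = Ax.
  apply: (is_sign_unique (hHi 0) (SiP _)).
  by rewrite /Hi scale0r addr0; exact: is_sign_involution.
apply: cvgM; first exact: cvg_cst.
have cS : {for (0 : R), continuous (fun e => complex.Re (\tr (L *m Si e)))}.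
  apply: continuous_Re_trace; apply: lipschitzM; first exact: lipschitz_cst.
  exact: (lipschitz_sign SiP (lip_inf 0)).
have cV : (r^-1 : R) @[r --> +oo] --> (0 : R).
  have pos : \forall r \near (pinfty_nbhs R), 0 < r by exact: nbhs_pinfty_gt.
  by apply/(gtr0_cvgV0 pos); exact: cvg_id.
have := cvg_comp _ _ cV cS; rewrite Si0; apply: cvg_trans; apply: near_eq_cvg.
near=> r; rewrite /= SiE //; near: r; exact: nbhs_pinfty_gt.
Unshelve. all: by end_near. Qed.

Let phi_bound : exists C : R, forall r : R, 0 <= r ->
  `|phi r| <= C * (1 + `|r|)^-1 ^+ 3.
Proof.
have [M1 M10 h1] := bounded_unit_interval phi_cont.
have cX : continuous (fun e => complex.Re (\tr (L *m Xi e))).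
  move=> e; apply: continuous_Re_trace; apply: lipschitzM; first exact: lipschitz_cst.
  exact: (lipschitz_sign_deriv SiP (lip_inf e) XiP).
have [M2 M20 h2] := bounded_unit_interval cX.
have q0 : 0 <= (4 * pi)^-1 :> R by rewrite invr_ge0 mulr_ge0 // pi_ge0.
(* M1 bounds phi on [0, 1] and M2 bounds the trace at infinity for e in [0, 1]. The factor 8 = 2^3
   comes from 1 + r <= 2 for r <= 1 and from 1/r <= 2 / (1 + r) for r >= 1. *)
exists (8 * (M1 + (4 * pi)^-1 * M2)) => r r0; rewrite (ger0_norm r0).
have p0 : 0 < 1 + r by rewrite ltr_wpDr.
have [r1|r1] := leP r 1.
  rewrite exprVn ler_pdivlMr ?exprn_gt0 //.
  have := h1 r r0 r1 => hb.
  have le8 : (1 + r) ^+ 3 <= 8.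
    rewrite (_ : 8 = 2 ^+ 3); last by rewrite !exprS expr0; lra.
    by rewrite lerXn2r ?nnegrE ?(ltW p0) //; lra.
  apply: (@le_trans _ _ (M1 * 8)).
    by rewrite ler_pM // exprn_ge0 // ltW.
  have := mulr_ge0 q0 M20; lra.
have rp : 0 < r by rewrite (lt_trans _ r1).
have e := r_phi rp; rewrite XiE // cmulmxZr mxtraceZ Re_mulC in e.
have hb := h2 r^-1; rewrite invr_ge0 (ltW rp) invf_le1 // (ltW r1) in hb.
have {}hb := hb isT isT.
have -> : phi r = - ((4 * pi)^-1 * r^-1 ^+ 3 * complex.Re (\tr (L *m Xi r^-1))).
  have rn : r != 0 by rewrite gt_eqF.
  apply: (mulfI rn); rewrite e; move: (4 * pi)^-1 (complex.Re _) => q z.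
  by field.
rewrite normrN !normrM ger0_norm // ger0_norm ?exprn_ge0 ?invr_ge0 ?(ltW rp) //.
have ler3 : r^-1 ^+ 3 <= 8 * (1 + r)^-1 ^+ 3.
  rewrite (_ : 8 = 2 ^+ 3); last by rewrite !exprS expr0; lra.
  rewrite -exprMn lerXn2r ?nnegrE ?mulr_ge0 ?invr_ge0 ?(ltW p0) ?(ltW rp) //.
  by rewrite ler_pdivlMr // mulrC ler_pdivrMr //; lra.
apply: (@le_trans _ _ ((4 * pi)^-1 * (8 * (1 + r)^-1 ^+ 3) * M2)).
  apply: ler_pM => //; last by rewrite ler_wpM2l.
  by rewrite !mulr_ge0 // invr_ge0 ltW.
have p3 : 0 <= (1 + r)^-1 ^+ 3 by rewrite exprn_ge0 // invr_ge0 ltW.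
have := mulr_ge0 M10 p3.
move: ((1 + r)^-1 ^+ 3) (4 * pi)^-1 => w q hw; lra.
Qed.

Theorem chern_rotation_family : chern (fun x y => negproj (H x y)) =
  (2^-1 * (complex.Re (\tr (L *m Ax)) - complex.Re (\tr (L *m S 0 0))))%:C.
Proof.
have [C hC] := phi_bound.
rewrite /chern -/F; apply/eqP; rewrite eq_complex /=; apply/andP; split; apply/eqP.
- transitivity (\int[@leb2 R]_z phi (hypot z.1 z.2)).
    by apply: eq_Rintegral => -[x y] _; exact: density_radial.
  rewrite (radial_integral phi_cont hC Phi_derive Phi0 Phi_lim) /Phi.
  by move: (pi : R) pi0 => q q0; field.
- transitivity (\int[@leb2 R]_z (0 : R)).
    by apply: eq_Rintegral => -[x y] _; exact: density_Im.
  by rewrite /Rintegral integral0.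
Qed.

End RotationFamily.

(** * The layer Hamiltonian *)

Section LayerMatrix.
Variables (R : realType) (m : nat).
Local Notation n := (m.*2).
Local Notation adj := (@adjmx R _).

(** In this order of the sites the Hamiltonian is tridiagonal. Bond p joins sites p and p + 1:
    inside a layer when p is even, between two layers when p is odd. *)
Definition hop (gamma x y : R) (p : nat) : R[i] :=
  if odd p then gamma%:C else x -i* y.

Lemma HhatE gamma v x y (p q : 'I_n) : Hhat m gamma v x y p q =
  (layer_pot m v p./2)%:C *+ (p == q :> nat) + hop gamma x y p *+ (q == p.+1 :> nat)
  + (hop gamma x y q)^* *+ (p == q.+1 :> nat).
Proof.
rewrite mxE /= !modn2 !divn2 /hop; move: (p : nat) (q : nat) => {p q} p q.
case: (ltngtP p q) => [pq|qp|<-].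
- have -> : (p == q.+1) = false by lia.
  rewrite !mulr0n add0r addr0.
  have [->|nq] := eqVneq q p.+1.
    rewrite /= uphalf_half; case: (odd p) => /=; rewrite ?add0n ?add1n ?eqxx //.
    by rewrite eqn_leq ltnn andbF.
  have -> : (p./2 == q./2) = false by lia.
  case: eqP => [e|_]; first by case: (odd p) (odd_double_half p) (odd q) (odd_double_half q) => [] h1 [] h2 //=; lia.
  by case: eqP => // e; lia.
- have -> : (q == p.+1) = false by lia.
  rewrite !mulr0n !add0r.
  have [->|nq] := eqVneq p q.+1.
    rewrite /= uphalf_half; case: (odd q) => /=; rewrite ?add0n ?add1n ?eqxx //=.
    - have -> : ((q./2).+1 == q./2) = false by lia.
      have -> : (q./2 == ((q./2).+1).+1) = false by lia.
      by apply/eqP; rewrite eq_complex /= ?oppr0 !eqxx.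
    - by apply/eqP; rewrite eq_complex /= ?opprK !eqxx.
  have -> : (p./2 == q./2) = false by lia.
  case: eqP => [e|_]; first lia.
  case: eqP => // e; case: (odd p) (odd_double_half p) (odd q) (odd_double_half q) => [] h1 [] h2 //=; lia.
- have -> : (p == p.+1) = false by lia.
  by rewrite !eqxx !addr0.
Qed.

Definition partner (p : nat) := if odd p then p.-1 else p.+1.

Lemma partner_lt p : (p < n)%N -> (partner p < n)%N.
Proof. by rewrite /partner; case: ifP => h1 h2; lia. Qed.

Lemma partnerK p : partner (partner p) = p.
Proof.
rewrite /partner; case op: (odd p).
  have -> : odd p.-1 = false by lia.
  by lia.
by rewrite /= op.
Qed.

Definition sigma_x : 'M[R[i]]_n := \matrix_(p, q) (q == partner p :> nat)%:R.
Definition sigma_y : 'M[R[i]]_n :=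
  \matrix_(p, q) ((if odd p then 'i else - 'i) *+ (q == partner p :> nat)).
(** The weight of site p counts the intralayer bonds before it, which are the bonds that carry
    kappa; the two ends of an interlayer bond have equal weight. *)
Definition winding : 'M[R[i]]_n := diag_mx (\row_p (uphalf p)%:R).

Lemma Hhat_planar gamma v x y : Hhat m gamma v x y =
  planar (Hhat m gamma v 0 0) sigma_x sigma_y x y.
Proof.
apply/matrixP => p q; rewrite [RHS]mxE [X in _ = X + _]mxE.
rewrite !HhatE ![in RHS]mxE /hop /partner.
case op: (odd p); case oq: (odd q).
all: move: (p : nat) (q : nat) op oq => {p q} p q op oq.
- have -> : (q == p.-1) = false by lia.
  by rewrite !mulr0 !addr0.
- have -> : (p == q) = false by lia.
  case: (eqVneq p q.+1) => [->|nq].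
    rewrite /= eqxx; have -> : (q == q.+2) = false by lia.
    by apply/eqP; rewrite eq_complex /=; apply/andP; split; apply/eqP; ring.
  have -> : (q == p.-1) = false by lia.
  by rewrite !mulr0n !mulr0 !addr0.
- have -> : (p == q) = false by lia.
  case: (eqVneq q p.+1) => [->|nq].
    have -> : (p == p.+2) = false by lia.
    by apply/eqP; rewrite eq_complex /=; apply/andP; split; apply/eqP; ring.
  by rewrite !mulr0n !mulr0 !addr0.
- have -> : (q == p.+1) = false by lia.
  have -> : (p == q.+1) = false by lia.
  by rewrite !mulr0n !mulr0 !addr0.
Qed.

Lemma Hhat_herm (gamma v x y : R) : selfadjoint (Hhat m gamma v x y).
Proof.
apply/matrixP => p q; rewrite !mxE -/(Hhat m gamma v x y) .
have := HhatE gamma v x y q p; rewrite !mxE => ->.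
have := HhatE gamma v x y p q; rewrite !mxE => ->.
rewrite !rmorphD !rmorphMn /= conjcK eq_sym.
case: (eqVneq (p : nat) q) => [->|_].
  rewrite !mulr1n; have -> : (q == q.+1 :> nat) = false by lia.
  by rewrite !addr0 oppr0.
by rewrite !mulr0n !add0r addrC.
Qed.

Lemma sigma_x_herm : selfadjoint sigma_x.
Proof.
apply/matrixP => p q; rewrite !mxE rmorph_nat; congr (_%:R); congr nat_of_bool.
by apply/eqP/eqP => ->; rewrite partnerK.
Qed.

Lemma sigma_y_herm : selfadjoint sigma_y.
Proof.
apply/matrixP => p q; rewrite !mxE rmorphMn /=.
have -> : (p == partner q :> nat) = (q == partner p :> nat).
  by apply/eqP/eqP => ->; rewrite partnerK.
case: eqP => [->|//]; rewrite /partner !mulr1n.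
case op: (odd p); last first.
  rewrite /= op /=; apply/eqP; rewrite eq_complex /= ?oppr0 ?opprK.
  by rewrite !eqxx.
have -> : odd p.-1 = false by lia.
by apply/eqP; rewrite eq_complex /= oppr0 opprK !eqxx.
Qed.

Lemma sigma_x_sq : sigma_x *m sigma_x = 1%:M.
Proof.
apply/matrixP => p q; rewrite !mxE (bigD1 (Ordinal (partner_lt (ltn_ord p)))) //=.
rewrite !mxE eqxx mul1r big1 ?addr0 => [|r /negPf hr].
  by rewrite partnerK eq_sym.
by rewrite !mxE -[(r == partner p :> nat)]/(r == Ordinal (partner_lt (ltn_ord p))) hr mul0r.
Qed.

Lemma trace_winding (M : 'M[R[i]]_n) :
  \tr (winding *m M) = \sum_(p < n) (uphalf p)%:R * M p p.
Proof. by apply: eq_bigr => p _; rewrite mul_diag_mx !mxE. Qed.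

Lemma trace_winding_sigma_x : \tr (winding *m sigma_x) = 0.
Proof.
rewrite trace_winding big1 // => p _; rewrite mxE.
have -> : (p == partner p :> nat) = false by rewrite /partner; case: ifP; lia.
by rewrite mulr0.
Qed.

Lemma winding_comm_entry (gamma v x y : R) (p q : 'I_n) :
  x%:C * sigma_y p q - y%:C * sigma_x p q =
  'i * ((uphalf p)%:R * Hhat m gamma v x y p q - Hhat m gamma v x y p q * (uphalf q)%:R).
Proof.
rewrite HhatE !mxE /hop /partner; move: ((layer_pot m v p./2)%:C) => P.
have sub z (w : R[i]) : z * w - w * z = 0 by ring.
have subl z (w : R[i]) : (z + 1) * w - w * z = w by ring.
have subr z (w : R[i]) : z * w - w * (z + 1) = - w by ring.
case op: (odd p); case oq: (odd q).
all: move: (p : nat) (q : nat) op oq => {p q} p q op oq.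
- have -> : (q == p.-1) = false by lia.
  have -> : (q == p.+1) = false by lia.
  have -> : (p == q.+1) = false by lia.
  by case: (p =P q) => [->|_]; rewrite ?mulr0n !addr0 ?sub ?mul0r ?mulr0 ?subrr ?mulr0.
- have -> : (p == q) = false by lia.
  case: (eqVneq p q.+1) => [e|nq].
    have -> : (q == p.+1) = false by lia.
    have -> : uphalf p = (uphalf q).+1 by lia.
    rewrite e eqxx -natr1 !mulr0n !add0r !mulr1n subl.
    by apply/eqP; rewrite eq_complex /=; apply/andP; split; apply/eqP; ring.
  have -> : (q == p.-1) = false by lia.
  case: (q =P p.+1) => [->|_]; last by rewrite !mulr0n !addr0 !mulr0 mul0r subrr mulr0.
  have -> : uphalf p.+1 = uphalf p by lia.
  by rewrite sub ?mulr0n !mulr0 subrr.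
- have -> : (p == q) = false by lia.
  case: (eqVneq q p.+1) => [e|nq].
    have -> : (p == q.+1) = false by lia.
    have -> : uphalf q = (uphalf p).+1 by lia.
    rewrite -natr1 !mulr0n add0r addr0 !mulr1n subr.
    by apply/eqP; rewrite eq_complex /=; apply/andP; split; apply/eqP; ring.
  case: (p =P q.+1) => [->|_]; last by rewrite !mulr0n !addr0 !mulr0 mul0r subrr mulr0.
  have -> : uphalf q.+1 = uphalf q by lia.
  by rewrite sub ?mulr0n !mulr0 subrr.
- have -> : (q == p.+1) = false by lia.
  have -> : (p == q.+1) = false by lia.
  by case: (p =P q) => [->|_]; rewrite ?mulr0n !addr0 ?sub ?mul0r ?mulr0 ?subrr ?mulr0.
Qed.

Lemma winding_comm (gamma v x y : R) : x%:C *: sigma_y - y%:C *: sigma_x =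
  'i *: (winding *m Hhat m gamma v x y - Hhat m gamma v x y *m winding).
Proof.
apply/matrixP => p q; have := winding_comm_entry gamma v x y p q.
rewrite /winding mul_diag_mx mul_mx_diag; move: (Hhat _ _ _ _ _) => M.
by rewrite !mxE.
Qed.

(** U is w to the power [winding], with w = (x + i y) / |x + i y|. An intralayer bond changes the
    exponent by one and receives the phase of kappa; an interlayer bond is left alone. *)
Lemma Hhat_rotation (gamma v x y : R) : hypot x y != 0 ->
  exists U : 'M[R[i]]_n, [/\ adj U *m U = 1%:M, U *m adj U = 1%:M,
    U *m winding = winding *m U & forall t,
    U *m Hhat m gamma v t 0 *m adj U =
    Hhat m gamma v (t * (x / hypot x y)) (t * (y / hypot x y))].
Proof.
move=> r0; pose w : R[i] := (x / hypot x y) +i* (y / hypot x y).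
have ww : w * w^* = 1.
  apply/eqP; rewrite eq_complex /=; apply/andP; split; apply/eqP; last by ring.
  have := sqr_sqrtr (addr_ge0 (sqr_ge0 x) (sqr_ge0 y)); rewrite -/(hypot x y) => h.
  have -> : x / hypot x y * (x / hypot x y) - y / hypot x y * - (y / hypot x y) =
    (x ^+ 2 + y ^+ 2) / hypot x y ^+ 2 by move: (hypot x y) r0 {w h} => r r0; field.
  by rewrite -h divff // sqrf_eq0.
have wwk k : w ^+ k * (w ^+ k)^* = 1 by rewrite rmorphXn -exprMn ww expr1n.
pose d : 'rV[R[i]]_n := \row_p w ^+ uphalf p.
have adjU : adj (diag_mx d) = diag_mx (\row_p (w ^+ uphalf p)^*).
  rewrite /adjmx map_diag_mx tr_diag_mx; congr diag_mx; apply/rowP => p.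
  by rewrite !mxE.
exists (diag_mx d); rewrite adjU; split.
- rewrite diag_mxC mulmx_diag; apply/matrixP => p q; rewrite !mxE.
  by case: eqP => // _; rewrite wwk.
- rewrite mulmx_diag; apply/matrixP => p q; rewrite !mxE.
  by case: eqP => // _; rewrite wwk.
- by rewrite /winding diag_mxC.
move=> t; apply/matrixP => p q; rewrite mul_diag_mx mul_mx_diag.
transitivity (w ^+ uphalf p * Hhat m gamma v t 0 p q * (w ^+ uphalf q)^*).
  by move: (Hhat m gamma v t 0) => M; rewrite !mxE.
rewrite !HhatE /hop !mulrDr !mulrDl.
congr (_ + _ + _).
- have [->|_] := eqVneq (p : nat) q; last by rewrite !mulr0n mulr0 mul0r.
  by rewrite !mulr1n mulrAC wwk mul1r.
- have [->|_] := eqVneq (q : nat) p.+1; last by rewrite !mulr0n mulr0 mul0r.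
  rewrite !mulr1n; case op: (odd p).
    have -> : uphalf p.+1 = uphalf p by lia.
    by rewrite mulrAC wwk mul1r.
  have -> : uphalf p.+1 = (uphalf p).+1 by lia.
  have e z b : z * b * (w * z)^* = z * z^* * (b * w^*) by rewrite rmorphM; ring.
  rewrite exprS e wwk mul1r.
  by apply/eqP; rewrite eq_complex /=; apply/andP; split; apply/eqP; ring.
- have [->|_] := eqVneq (p : nat) q.+1; last by rewrite !mulr0n mulr0 mul0r.
  rewrite !mulr1n; case oq: (odd q).
    have -> : uphalf q.+1 = uphalf q by lia.
    by rewrite mulrAC wwk mul1r.
  have -> : uphalf q.+1 = (uphalf q).+1 by lia.
  have e z b : w * z * b * z^* = z * z^* * (b * w) by ring.
  rewrite exprS e wwk mul1r.
  by apply/eqP; rewrite eq_complex /=; apply/andP; split; apply/eqP; ring.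
Qed.

End LayerMatrix.

(** * Invertibility of the layer Hamiltonian *)

Lemma conjc_real_comb (R : realType) (a b c : R) (x y z : R[i]) :
  a%:C * x + b%:C * y + c%:C * z = 0 ->
  a%:C * x^* + b%:C * y^* + c%:C * z^* = 0.
Proof.
case: x y z => [x1 x2] [y1 y2] [z1 z2] h.
have := congr1 (@complex.Re R) h; have := congr1 (@complex.Im R) h => /= h1 h2.
by apply/eqP; rewrite eq_complex /=; apply/andP; split; apply/eqP; lra.
Qed.

(* The flipped conjugate [chi] of a kernel vector solves the equation with the
   opposite diagonal, so the Wronskian-like product [V] vanishes at every bond;
   at the middle bond it is a multiple of a sum of squares. *)
Lemma chain_kernel (R : realType) (m : nat) (u t : nat -> R) (psi : nat -> R[i]) :
  (0 < m)%N ->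
  (forall k, (k < m.*2)%N -> u (m.*2 - k.+1)%N = - u k) ->
  (forall k, (k.+1 < m.*2)%N -> t (m.*2 - k.+2)%N = t k) ->
  (forall k, t k != 0) ->
  (t 0%N)%:C * psi 1%N + (u 0%N)%:C * psi 0%N = 0 ->
  (forall k, (k.+1 < m.*2)%N -> (t k.+1)%:C * psi k.+2 + (u k.+1)%:C * psi k.+1
     + (t k)%:C * psi k = 0) ->
  psi m.*2 = 0 ->
  forall k, (k < m.*2)%N -> psi k = 0.
Proof.
move=> m0 hu ht tn0 eq0 eqS psin.
pose chi k := (psi (m.*2 - k.+1)%N)^*.
have tC k (z : R[i]) : (t k)%:C * z = 0 -> z = 0.
  by move/eqP; rewrite mulf_eq0 fmorph_eq0 (negPf (tn0 k)) => /eqP.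
have chiS k : (k.+2 < m.*2)%N ->
  (t k.+1)%:C * chi k.+2 - (u k.+1)%:C * chi k.+1 + (t k)%:C * chi k = 0.
  move=> hk; have hj : ((m.*2 - k.+3).+1 < m.*2)%N by lia.
  have := conjc_real_comb (eqS _ hj).
  have -> : (m.*2 - k.+3).+2 = (m.*2 - k.+1)%N by lia.
  have -> : (m.*2 - k.+3).+1 = (m.*2 - k.+2)%N by lia.
  have -> : t (m.*2 - k.+2)%N = t k by apply: ht; lia.
  have -> : t (m.*2 - k.+3)%N = t k.+1 by apply: ht; lia.
  have -> : u (m.*2 - k.+2)%N = - u k.+1 by apply: hu; lia.
  by rewrite rmorphN /chi => <-; ring.
(* The first equation for chi is the last one for psi, where psi at m.*2 is the zero boundary
   value. *)
have chi0 : (t 0%N)%:C * chi 1%N - (u 0%N)%:C * chi 0%N = 0.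
  have hj : ((m.*2 - 2).+1 < m.*2)%N by lia.
  have := eqS _ hj.
  have -> : (m.*2 - 2).+2 = m.*2 by lia.
  have -> : (m.*2 - 2).+1 = (m.*2 - 1)%N by lia.
  have -> : t (m.*2 - 2)%N = t 0%N by apply: ht; lia.
  have -> : u (m.*2 - 1)%N = - u 0%N by apply: hu; lia.
  rewrite psin mulr0 -[in LHS](mul0r 0) -{1}(rmorph0 (real_complex R)).
  move/conjc_real_comb; rewrite rmorph0 mul0r add0r rmorphN /chi => <-.
  by ring.
pose V k := (t k)%:C * (psi k * chi k.+1 + psi k.+1 * chi k).
have V0 k : (k.+1 < m.*2)%N -> V k = 0.
  elim: k => [_|k IH hk].
    rewrite /V.
    transitivity (psi 0%N * ((t 0%N)%:C * chi 1%N - (u 0%N)%:C * chi 0%N)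
      + chi 0%N * ((t 0%N)%:C * psi 1%N + (u 0%N)%:C * psi 0%N)); first by ring.
    by rewrite chi0 eq0 !mulr0 addr0.
  have hk' : (k.+1 < m.*2)%N by lia.
  have e1 := IH hk'; rewrite -[LHS]addr0 -e1 /V.
  transitivity (psi k.+1 * ((t k.+1)%:C * chi k.+2 - (u k.+1)%:C * chi k.+1 + (t k)%:C * chi k)
    + chi k.+1 * ((t k.+1)%:C * psi k.+2 + (u k.+1)%:C * psi k.+1 + (t k)%:C * psi k)).
    by ring.
  by rewrite chiS // eqS // !mulr0 addr0.
have [p1 p2] : psi m.-1 = 0 /\ psi m = 0.
  have hm : (m.-1.+1 < m.*2)%N by lia.
  have := tC _ _ (V0 _ hm); rewrite /chi (prednK m0).
  have -> : (m.*2 - m.+1)%N = m.-1 by lia.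
  have -> : (m.*2 - m)%N = m by lia.
  move=> h.
  have a0 := mulcJ_ge0 (psi m.-1); have b0 := mulcJ_ge0 (psi m).
  move/eqP: h; rewrite paddr_eq0 // !mulf_eq0 !conjc_eq0 !orbb => /andP[/eqP ? /eqP ?].
  by [].
(* Two adjacent zeros spread along the recurrence in both directions because no coupling is zero. *)
have down j : (j <= m.-1)%N -> psi (m.-1 - j)%N = 0 /\ psi (m - j)%N = 0.
  elim: j => [|j IH] hj; first by rewrite !subn0.
  have [|q1 q2] := IH; first by lia.
  have hk : ((m.-1 - j.+1).+1 < m.*2)%N by lia.
  have := eqS _ hk.
  have -> : (m.-1 - j.+1).+2 = (m - j)%N by lia.
  have -> : (m.-1 - j.+1).+1 = (m.-1 - j)%N by lia.
  rewrite q1 q2 !mulr0 !add0r => /tC ->; split => //.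
  by rewrite -[RHS]q1; congr psi; lia.
have up j : (m + j < m.*2)%N -> psi (m.-1 + j)%N = 0 /\ psi (m + j)%N = 0.
  elim: j => [|j IH] hj; first by rewrite !addn0.
  have [|q1 q2] := IH; first by lia.
  have hk : ((m.-1 + j).+1 < m.*2)%N by lia.
  have := eqS _ hk.
  have -> : (m.-1 + j).+2 = (m + j.+1)%N by lia.
  have -> : (m.-1 + j).+1 = (m + j)%N by lia.
  rewrite q1 q2 !mulr0 !addr0 => /tC ->; split => //.
  by rewrite -[RHS]q2; congr psi; lia.
move=> k hk; have [hkm|hkm] := ltnP k m.
  have [|+ _] := down (m.-1 - k)%N; first by lia.
  by have -> : (m.-1 - (m.-1 - k))%N = k by lia.
have [|_] := up (k - m)%N; first by lia.
by have -> : (m + (k - m))%N = k by lia.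
Qed.

Section KernelHhat.
Variables (R : realType) (m : nat).
Local Notation n := (m.*2).

(** Extension by zero past the last site lets the last equation have the same form as the interior
    ones. *)
Definition row_fun (v : 'rV[R[i]]_n) (k : nat) : R[i] :=
  oapp (fun p : 'I_n => v 0 p) 0 (insub k).

Lemma row_funE (v : 'rV[R[i]]_n) (p : 'I_n) : row_fun v p = v 0 p.
Proof. by rewrite /row_fun valK. Qed.

Lemma row_fun_out v k : (n <= k)%N -> row_fun v k = 0.
Proof. by move=> h; rewrite /row_fun insubF //; lia. Qed.

Lemma sum_row_delta (v : 'rV[R[i]]_n) (c : nat -> R[i]) k :
  \sum_(p < n) v 0 p * (c p *+ (p == k :> nat)) = row_fun v k * c k.
Proof.
have [hk|hk] := ltnP k n.
  rewrite (bigD1 (Ordinal hk)) //= eqxx mulr1n big1 => [|p hp].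
    by rewrite addr0 -row_funE.
  by rewrite (negPf (hp : (p : nat) != k)) mulr0n mulr0.
rewrite row_fun_out // mul0r big1 // => p _.
have -> : (p == k :> nat) = false by have := ltn_ord p; lia.
by rewrite mulr0n mulr0.
Qed.

Lemma row_mul_Hhat (v : 'rV[R[i]]_n) (gamma pot x y : R) (q : 'I_n) :
  (v *m Hhat m gamma pot x y) 0 q =
  row_fun v q * (layer_pot m pot q./2)%:C
  + (if (q : nat) is k.+1 then row_fun v k * hop gamma x y k else 0)
  + row_fun v q.+1 * (hop gamma x y q)^*.
Proof.
rewrite mxE; under eq_bigr do rewrite HhatE !mulrDr.
rewrite !big_split /=; congr (_ + _ + _).
- exact: (sum_row_delta v (fun p => (layer_pot m pot p./2)%:C) q).
- case: (q : nat) => [|k].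
    by rewrite big1 // => p _; rewrite mulr0.
  rewrite -(sum_row_delta v (hop gamma x y)); apply: eq_bigr => p _.
  by rewrite eqSS eq_sym.
- exact: (sum_row_delta v (fun=> (hop gamma x y q)^*) q.+1).
Qed.

Lemma unitmx_row_ker (M : 'M[R[i]]_n) :
  (forall v : 'rV_n, v *m M = 0 -> forall k, (k < n)%N -> row_fun v k = 0) ->
  M \in unitmx.
Proof.
move=> h; rewrite -row_free_unit; apply: inj_row_free => v hv; apply/rowP => p.
by rewrite -row_funE mxE h.
Qed.

Lemma layer_pot_anti v k : (k < m)%N -> layer_pot m v (m - k.+1)%N = - layer_pot m v k :> R.
Proof.
move=> km; rewrite /layer_pot -[RHS]mulrN; congr (_ * _).
have -> : (m - k.+1).+1 = (m - k)%N by lia.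
rewrite natrB; last by lia.
by rewrite -(natr1 k); lra.
Qed.

Hypothesis m2 : (2 <= m)%N.

(** On the axis the couplings r and gamma are real, nonzero and symmetric under reversal of the
    chain, and the potential is antisymmetric: the setting of [chain_kernel]. *)
Lemma unit_Hhat_axis (gamma v r : R) : gamma != 0 -> r != 0 ->
  Hhat m gamma v r 0 \in unitmx.
Proof.
move=> g0 r0; apply: unitmx_row_ker => w hw.
pose t k := if odd k then gamma else r.
have hopE k : hop gamma r 0 k = (t k)%:C.
  by rewrite /hop /t; case: ifP => // _; rewrite oppr0.
have hopJ k : (hop gamma r 0 k)^* = (t k)%:C.
  by rewrite /hop /t; case: ifP => _; apply/eqP; rewrite eq_complex /= ?oppr0 !eqxx.
have eqn q (hq : (q < n)%N) : row_fun w q * (layer_pot m v q./2)%:C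
  + (if q is k.+1 then row_fun w k * (t k)%:C else 0)
  + row_fun w q.+1 * (t q)%:C = 0.
  have := row_mul_Hhat w gamma v r 0 (Ordinal hq); rewrite hw mxE /= => e.
  rewrite [RHS]e; congr (_ + _ + _ * _); last exact/esym/hopJ.
  by case: q {hq e} => // k; rewrite hopE.
apply: (@chain_kernel R m (fun k => layer_pot m v k./2) t); first by lia.
- move=> k hk; have -> : ((n - k.+1)./2 = m - (k./2).+1)%N by lia.
  by apply: layer_pot_anti; lia.
- move=> k hk; rewrite /t.
  by have -> : odd (n - k.+2) = odd k by lia.
- by move=> k; rewrite /t; case: ifP.
- have /eqn : (0 < n)%N by lia.
  by rewrite addr0 addrC => <-; rewrite ![_%:C * _]mulrC.
- by move=> k /eqn <-; ring.
- by rewrite row_fun_out.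
Qed.

(** With the even bonds cut, the two end sites carry nonzero potentials, and the remaining 2x2
    blocks have determinant [layer_pot m v k * layer_pot m v k.+1 - gamma ^+ 2]. *)
Lemma unit_Hhat0 (gamma v : R) : v != 0 ->
  (forall k, (k.+1 < m)%N ->
     layer_pot m v k * layer_pot m v k.+1 != gamma ^+ 2) ->
  Hhat m gamma v 0 0 \in unitmx.
Proof.
move=> v0 hd; apply: unitmx_row_ker => w hw.
have pot0 : layer_pot m v 0 != 0.
  rewrite /layer_pot !mulf_neq0 // ?invr_eq0.
    by rewrite subr_eq0 pnatr_eq1; lia.
  rewrite lt_eqF // mulr1n.
  have : (2%:R : R) <= m%:R by rewrite ler_nat.
  lra.
have potm : layer_pot m v m.-1 != 0.
  have := @layer_pot_anti v 0; have -> : (m - 1)%N = m.-1 by lia.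
  by move=> -> //; [rewrite oppr_eq0|lia].
pose t k := if odd k then gamma else 0.
have hopE k : hop gamma 0 0 k = (t k)%:C.
  by rewrite /hop /t; case: ifP => // _; rewrite oppr0.
have hopJ k : (hop gamma 0 0 k)^* = (t k)%:C.
  by rewrite /hop /t; case: ifP => _; apply/eqP; rewrite eq_complex /= ?oppr0 !eqxx.
have eqn q (hq : (q < n)%N) : row_fun w q * (layer_pot m v q./2)%:C
  + (if q is k.+1 then row_fun w k * (t k)%:C else 0)
  + row_fun w q.+1 * (t q)%:C = 0.
  have := row_mul_Hhat w gamma v 0 0 (Ordinal hq); rewrite hw mxE /= => e.
  rewrite [RHS]e; congr (_ + _ + _ * _); last exact/esym/hopJ.
  by case: q {hq e} => // k; rewrite hopE.
move=> k hk.
have C0 (a : R) (z : R[i]) : a != 0 -> z * a%:C = 0 -> z = 0.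
  by move=> a0 /eqP; rewrite mulf_eq0 fmorph_eq0 (negPf a0) orbF => /eqP.
have pair j : (j.+1 < m)%N -> row_fun w j.*2.+1 = 0 /\ row_fun w j.*2.+2 = 0.
  move=> hj.
  have h1 : (j.*2.+1 < n)%N by lia.
  have h2 : (j.*2.+2 < n)%N by lia.
  have := eqn _ h1; have := eqn _ h2.
  have -> : (j.*2.+2)./2 = j.+1 by lia.
  have -> : (j.*2.+1)./2 = j by lia.
  have t0 : t j.*2 = 0 by rewrite /t odd_double.
  have t1 : t j.*2.+1 = gamma by rewrite /t /= odd_double.
  have t2 : t j.*2.+2 = 0 by rewrite /t /= odd_double.
  rewrite t0 t1 t2 !mulr0 !addr0.
  set a := row_fun w j.*2.+1; set b := row_fun w j.*2.+2.
  move=> e2 e1.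
  have := hd j hj; set al := layer_pot m v j; set be := layer_pot m v j.+1 => hdj.
  have hdj' : al * be - gamma ^+ 2 != 0 by rewrite subr_eq0.
  (* Cramer's rule for the block. *)
  split; apply: (C0 _ _ hdj'); rewrite rmorphB rmorphM rmorphXn /=.
    transitivity (be%:C * (a * al%:C + b * gamma%:C) - gamma%:C * (b * be%:C + a * gamma%:C)).
      by ring.
    by rewrite e1 e2 !mulr0 subrr.
  transitivity (al%:C * (b * be%:C + a * gamma%:C) - gamma%:C * (a * al%:C + b * gamma%:C)).
    by ring.
  by rewrite e1 e2 !mulr0 subrr.
have [->|k0] := eqVneq k 0%N.
  have h : (0 < n)%N by lia.
  have := eqn _ h; rewrite /t /= mulr0 !addr0.
  exact: C0.
have [e|kl] := eqVneq k n.-1.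
  have := eqn _ hk.
  rewrite [row_fun w k.+1]row_fun_out; last by lia.
  rewrite mul0r addr0; have -> : k./2 = m.-1 by lia.
  case: k hk k0 e => // k hk _ e; rewrite /t.
  have -> : odd k = false by lia.
  rewrite mulr0 addr0; exact: C0.
case ok : (odd k).
  have [|+ _] := pair k./2; first by lia.
  by have -> : k./2.*2.+1 = k by lia.
have [|_] := pair k./2.-1; first by lia.
by have -> : k./2.-1.*2.+2 = k by lia.
Qed.

End KernelHhat.

(** * The spectral projector at kappa = 0, block by block *)

Section TraceAtZero.
Variables (R : realType) (m : nat).
Local Notation n := (m.*2).
Local Notation pot := (layer_pot m).

Lemma hop00 (gamma : R) k : hop gamma 0 0 k = (if odd k then gamma else 0)%:C.
Proof. by rewrite /hop; case: ifP => // _; rewrite oppr0. Qed.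

Lemma conj_hop00 (gamma : R) k : (hop gamma 0 0 k)^* = (if odd k then gamma else 0)%:C.
Proof.
by rewrite /hop; case: ifP => _; apply/eqP; rewrite eq_complex /= ?oppr0 !eqxx.
Qed.

Lemma Hhat00E (gamma v : R) (p q : 'I_n) : Hhat m gamma v 0 0 p q =
  (pot v p./2 *+ (p == q :> nat) + gamma *+ (odd p && (q == p.+1 :> nat))
   + gamma *+ (odd q && (p == q.+1 :> nat)))%:C.
Proof.
rewrite HhatE !rmorphD !rmorphMn; congr (_ + _ + _).
  by rewrite hop00; case: (odd p); rewrite ?mul0rn ?mulr0n.
transitivity ((if odd q then gamma else 0)%:C *+ (p == q.+1 :> nat)).
  by congr (_ *+ _); exact: conj_hop00.
by case: (odd q); rewrite ?mul0rn ?mulr0n.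
Qed.

Definition pair_vec (p q : 'I_n) (a b : R) : 'cV[R[i]]_n :=
  a%:C *: delta_mx p 0 + b%:C *: delta_mx q 0.

Lemma pair_vecE p q a b r :
  pair_vec p q a b r 0 = (a *+ (r == p) + b *+ (r == q))%:C.
Proof.
rewrite !mxE !andbT rmorphD !rmorphMn /=.
by congr (_ + _); [case: (r == p)|case: (r == q)]; rewrite ?mulr1 ?mulr0.
Qed.

Lemma mul_pair_vec (M : 'M[R[i]]_n) p q a b r :
  (M *m pair_vec p q a b) r 0 = a%:C * M r p + b%:C * M r q.
Proof. by rewrite mulmxDr -!scalemxAr -!colE !mxE. Qed.

(** The hypothesis on l is the characteristic equation of block k, and (gamma, l - pot k) is the
    eigenvector read off its first row. *)
Lemma Hhat00_pair_eigen (gamma v l : R) k (p q : 'I_n) :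
  p = k.*2.+1 :> nat -> q = k.*2.+2 :> nat ->
  (l - pot v k) * (l - pot v k.+1) = gamma ^+ 2 ->
  Hhat m gamma v 0 0 *m pair_vec p q gamma (l - pot v k) =
  l%:C *: pair_vec p q gamma (l - pot v k).
Proof.
move=> pE qE hl.
apply/colP => r; rewrite mul_pair_vec [RHS]mxE pair_vecE !Hhat00E -!rmorphM -rmorphD.
congr (_%:C); rewrite -!val_eqE /= pE qE; move: (r : nat) => {p q pE qE}r.
have z1 : (odd k.*2.+2 && (r == k.*2.+3)) = false by lia.
rewrite z1 mulr0n addr0.
have [->|r1] := eqVneq r k.*2.+1.
  have -> : (odd k.*2.+1 && (k.*2.+1 == k.*2.+2)) = false by lia.
  have -> : (odd k.*2.+1 && (k.*2.+2 == k.*2.+2)) = true by lia.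
  have -> : (k.*2.+1 == k.*2.+2) = false by lia.
  have -> : (k.*2.+1)./2 = k by lia.
  by rewrite !mulr1n !mulr0n; ring.
have [->|r2] := eqVneq r k.*2.+2.
  have -> : (odd k.*2.+2 && (k.*2.+1 == k.*2.+3)) = false by lia.
  have -> : (odd k.*2.+2 && (k.*2.+2 == k.*2.+3)) = false by lia.
  have -> : (odd k.*2.+1 && true) = true by lia.
  have -> : (k.*2.+2)./2 = k.+1 by lia.
  rewrite !mulr1n !mulr0n !addr0 !add0r.
  have -> : l * (l - pot v k) = (l - pot v k) * (l - pot v k.+1) + (l - pot v k) * pot v k.+1.
    by ring.
  by rewrite hl expr2.
have -> : (odd r && (k.*2.+1 == r.+1)) = false by lia.
have -> : (odd r && (k.*2.+2 == r.+1)) = false by lia.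
by rewrite andbF !mulr0n !addr0 !mulr0 addr0.
Qed.

Variables (gamma v : R) (P : 'M[R[i]]_n).
Hypothesis hP : is_neg_proj (Hhat m gamma v 0 0) P.

Lemma neg_proj_last_entry (p : 'I_n) : p = n.-1 :> nat ->
  P p p = (pot v m.-1 < 0)%R%:R%:C.
Proof.
move=> pE; have [_ _ hv] := hP.
pose x : 'cV[R[i]]_n := delta_mx p 0.
have x0 : x != 0.
  by apply/eqP => /colP/(_ p); rewrite !mxE !eqxx => /eqP; rewrite oner_eq0.
have np := ltn_ord p.
have Hx : Hhat m gamma v 0 0 *m x = (pot v m.-1)%:C *: x.
  rewrite /x -colE; apply/colP => r; rewrite [LHS]mxE Hhat00E !mxE andbT -val_eqE /= pE.
  have nr := ltn_ord r; move: (r : nat) nr => {}r nr.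
  have -> : (odd r && (n.-1 == r.+1)) = false.
    by apply/negP => /andP[h /eqP e]; lia.
  have -> : (r == n.-1.+1) = false by lia.
  rewrite andbF !addr0; case: eqP => [->|_]; last by rewrite mulr0.
  by rewrite mulr1; have -> : n.-1./2 = m.-1 by lia.
have [n1 n2] := hv _ _ x0 Hx.
have e : ((pot v m.-1)%:C < 0) = (pot v m.-1 < 0) by rewrite ltcE /= eqxx.
rewrite e in n1 n2.
have -> : P p p = (P *m x) p 0 by rewrite /x -colE mxE.
case: (boolP (pot v m.-1 < 0)) => h.
  by rewrite n1 // !mxE !eqxx.
by rewrite n2 // mxE.
Qed.

Hypothesis gamma0 : 0 < gamma.

(** P is known through its action on two eigenvectors, independent because l1 and l2 differ; solving
    for its diagonal entries gives the number of negative eigenvalues of the block. *)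
Lemma neg_proj_pair_trace k (p q : 'I_n) (l1 l2 : R) :
  p = k.*2.+1 :> nat -> q = k.*2.+2 :> nat -> l1 != l2 ->
  (l1 - pot v k) * (l1 - pot v k.+1) = gamma ^+ 2 ->
  (l2 - pot v k) * (l2 - pot v k.+1) = gamma ^+ 2 ->
  P p p + P q q = ((l1 < 0)%R%:R + (l2 < 0)%R%:R)%:C.
Proof.
move=> pE qE l12 h1 h2; have [_ _ hv] := hP.
have qp : (q == p) = false by rewrite -val_eqE /= pE qE; lia.
have pq : (p == q) = false by rewrite eq_sym.
have ev l : (l - pot v k) * (l - pot v k.+1) = gamma ^+ 2 ->
  (gamma%:C * P p p + (l - pot v k)%:C * P p q = (l < 0)%R%:R%:C * gamma%:C) /\
  (gamma%:C * P q p + (l - pot v k)%:C * P q q = (l < 0)%R%:R%:C * (l - pot v k)%:C).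
  move=> hl; set x := pair_vec p q gamma (l - pot v k).
  have x0 : x != 0.
    apply/eqP => /colP/(_ p); rewrite pair_vecE eqxx pq mulr1n mulr0n addr0 mxE.
    by move/eqP; rewrite fmorph_eq0 gt_eqF.
  have Px : P *m x = (l < 0)%R%:R%:C *: x.
    have [n1 n2] := hv _ _ x0 (Hhat00_pair_eigen pE qE hl).
    have e : (l%:C < 0) = (l < 0) by rewrite ltcE /= eqxx.
    rewrite e in n1 n2; case: (boolP (l < 0)) => hl0.
      by rewrite n1 // scale1r.
    by rewrite n2 // scale0r.
  split.
    have /colP/(_ p) := Px; rewrite mul_pair_vec [X in _ = X]mxE pair_vecE.
    by rewrite eqxx pq mulr1n mulr0n addr0.
  have /colP/(_ q) := Px; rewrite mul_pair_vec [X in _ = X]mxE pair_vecE.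
  by rewrite eqxx qp mulr1n mulr0n add0r.
have [a1 b1] := ev _ h1; have [a2 b2] := ev _ h2.
have nz : (gamma * (l1 - l2))%:C != 0.
  by rewrite fmorph_eq0 mulf_eq0 subr_eq0 (negPf l12) orbF gt_eqF.
apply: (mulfI nz); move: a1 b1 a2 b2.
rewrite !rmorphM !rmorphD !rmorphN /=.
move: (P p p) (P p q) (P q p) (P q q) (l1%:C) (l2%:C) (gamma%:C) ((pot v k)%:C)
  ((l1 < 0)%R%:R%:C) ((l2 < 0)%R%:R%:C) => A B C D x y g z c d a1 b1 a2 b2.
(* Subtracting the two eigenvector equations in the first row gives B, and in the second row D; A
   then follows from the first row. *)
have e1 : (x - y) * B = (c - d) * g.
  transitivity ((g * A + (x - z) * B) - (g * A + (y - z) * B)); first by ring.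
  by rewrite a1 a2; ring.
have e2 : (x - y) * D = c * (x - z) - d * (y - z).
  transitivity ((g * C + (x - z) * D) - (g * C + (y - z) * D)); first by ring.
  by rewrite b1 b2.
transitivity ((x - y) * (g * A + (x - z) * B) - (x - z) * ((x - y) * B) + g * ((x - y) * D)).
  by ring.
by rewrite a1 e1 e2; ring.
Qed.

End TraceAtZero.

(** * Phases *)

Section Phases.
Variable R : realType.

(** For the block with diagonal a, b and coupling g: a negative determinant means one negative
    eigenvalue, a positive one means two eigenvalues with the sign of a, hence 1 - sg a negative
    ones. *)
Lemma two_by_two_roots (g a b : R) : 0 < g -> a * b != g ^+ 2 ->
  exists l1 l2 : R, [/\ l1 != l2, (l1 - a) * (l1 - b) = g ^+ 2,
    (l2 - a) * (l2 - b) = g ^+ 2 &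
    (l1 < 0)%R%:R + (l2 < 0)%R%:R = (if a * b < g ^+ 2 then 1 else 1 - Num.sg a) :> R].
Proof.
move=> g0 hab; pose s := Num.sqrt ((a - b) ^+ 2 + 4 * g ^+ 2).
have g2 : 0 < g ^+ 2 by rewrite exprn_gt0.
have arg0 : 0 < (a - b) ^+ 2 + 4 * g ^+ 2 by have := sqr_ge0 (a - b); lra.
have s2 : s ^+ 2 = (a - b) ^+ 2 + 4 * g ^+ 2 by rewrite sqr_sqrtr // ltW.
have s0 : 0 < s by rewrite sqrtr_gt0.
exists ((a + b + s) / 2), ((a + b - s) / 2).
have e1 : ((a + b + s) / 2 - a) * ((a + b + s) / 2 - b) = (s ^+ 2 - (a - b) ^+ 2) / 4.
  by field.
have e2 : ((a + b - s) / 2 - a) * ((a + b - s) / 2 - b) = (s ^+ 2 - (a - b) ^+ 2) / 4.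
  by field.
(* The determinant decides whether s or |a + b| is larger, hence the signs of (a + b + s)/2 and (a +
   b - s)/2. *)
have key : s ^+ 2 - (a + b) ^+ 2 = 4 * (g ^+ 2 - a * b) by rewrite s2; ring.
split.
- by apply/eqP; lra.
- by rewrite e1 s2; lra.
- by rewrite e2 s2; lra.
have [lt|ge] := ltP (a * b) (g ^+ 2).
  have h : `|a + b| < s.
    rewrite -(ltr_pXn2r (n := 2)) ?nnegrE ?(ltW s0) // real_normK ?num_real //; lra.
  move: h; rewrite ltr_norml => /andP[h1 h2].
  have -> : ((a + b + s) / 2 < 0) = false by apply/negP; lra.
  have -> : ((a + b - s) / 2 < 0) = true by lra.
  by rewrite add0r.
have gt : g ^+ 2 < a * b by rewrite lt_def hab.
have h : s < `|a + b|.
  rewrite -(ltr_pXn2r (n := 2)) ?nnegrE ?(ltW s0) // real_normK ?num_real //; lra.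
have ab0 : 0 < a * b by lra.
have [an|ap|a0] := ltrgt0P a; last by move: ab0; rewrite a0 mul0r ltxx.
- have bp : 0 < b by rewrite -(pmulr_rgt0 b an).
  move: h; rewrite gtr0_norm ?addr_gt0 // => h.
  have -> : ((a + b + s) / 2 < 0) = false by apply/negP; lra.
  have -> : ((a + b - s) / 2 < 0) = false by apply/negP; lra.
  by rewrite gtr0_sg // subrr addr0.
- have bp : b < 0 by rewrite -(nmulr_rgt0 b ap).
  move: h; rewrite ltr0_norm; last by lra.
  move=> h.
  have -> : ((a + b + s) / 2 < 0) = true by lra.
  have -> : ((a + b - s) / 2 < 0) = true by lra.
  by rewrite ltr0_sg // opprK.
Qed.

Lemma sum_pairs (g : nat -> R) m : \sum_(p < m.+1.*2) g p =
  g 0%N + \sum_(k < m) (g k.*2.+1 + g k.*2.+2) + g m.*2.+1.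
Proof.
elim: m => [|m IH].
  by rewrite !big_ord_recr !big_ord0 /= add0r addr0.
by rewrite doubleS 2!big_ord_recr IH [in RHS]big_ord_recr /= !addrA.
Qed.

Section Fixed.
Variable m : nat.
Hypothesis m2 : (2 <= m)%N.
Local Notation n := (m.*2).
Local Notation pot := (layer_pot m).
Variables gamma v : R.
Hypothesis gamma0 : 0 < gamma.
Hypothesis v0 : v != 0.
Hypothesis nondeg : forall k, (k.+1 < m)%N -> pot v k * pot v k.+1 != gamma ^+ 2.

(** The signature of block k, that is the trace of the sign restricted to it. *)
Definition block_charge (k : nat) : R :=
  if pot v k * pot v k.+1 < gamma ^+ 2 then 0 else 2 * Num.sg (pot v k).

Let pot_last : pot v m.-1 != 0.
Proof.
rewrite /layer_pot mulf_neq0 // ?mulf_neq0 ?invr_eq0 //.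
  by rewrite subr_eq0 pnatr_eq1; lia.
rewrite prednK; last by lia.
have : (2%:R : R) <= m%:R by rewrite ler_nat.
by move=> h; rewrite gt_eqF //; lra.
Qed.

Lemma winding_trace_at0 P : is_neg_proj (Hhat m gamma v 0 0) P ->
  complex.Re (\tr (@winding R m *m (1%:M - 2%:C *: P))) =
  m%:R * Num.sg (pot v m.-1) + \sum_(k < m.-1) k.+1%:R * block_charge k.
Proof.
move=> hP; rewrite trace_winding.
pose s (k : nat) : R := oapp (fun p : 'I_n => 1 - 2 * complex.Re (P p p)) 0 (insub k).
have -> : \sum_(p < n) (uphalf p)%:R * (1%:M - 2%:C *: P) p p =
   \sum_(p < n) (uphalf p)%:R * (1 - 2%:C * P p p).
  by apply: eq_bigr => p _; rewrite !mxE eqxx.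
rewrite Re_sum.
have -> : \sum_(p < n) complex.Re ((uphalf p)%:R * (1 - 2%:C * P p p)) =
   \sum_(p < n) (uphalf p)%:R * s p.
  apply: eq_bigr => p _; rewrite /s valK /=.
  by rewrite -(rmorph_nat (real_complex R)) Re_mulC ReB Re_mulC.
have mE : m = m.-1.+1 by lia.
(* Site 0 has weight 0 and drops out, the last site has weight m, and both sites of block k have
   weight k + 1. *)
rewrite [in LHS]mE (sum_pairs (fun p => (uphalf p)%:R * s p)) mul0r add0r addrC.
congr (_ + _).
  have hl : (n.-1 < n)%N by lia.
  have -> : (m.-1.*2.+1 = n.-1)%N by lia.
  have -> : uphalf n.-1 = m by lia.
  congr (_ * _); rewrite /s (insubT (fun k => k < n)%N hl) /=.
  rewrite (neg_proj_last_entry hP) //= -/(Num.sg _).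
  have [p|p|/eqP p] := ltrgt0P (pot v m.-1); last by rewrite (negPf pot_last) in p.
    by rewrite gtr0_sg // mulr0 subr0.
  by rewrite ltr0_sg // mulr1; lra.
apply: eq_bigr => k _; have hk := ltn_ord k.
have h1 : (k.*2.+1 < n)%N by lia.
have h2 : (k.*2.+2 < n)%N by lia.
have -> : uphalf k.*2.+1 = k.+1 by lia.
have -> : uphalf k.*2.+2 = k.+1 by lia.
rewrite -mulrDr; congr (_ * _).
rewrite /s (insubT (fun k => k < n)%N h1) (insubT (fun k => k < n)%N h2) /=.
have hkm : (k.+1 < m)%N by lia.
have [l1 [l2 [l12 e1 e2 cnt]]] := two_by_two_roots gamma0 (nondeg hkm).
have := neg_proj_pair_trace hP gamma0 (p := Sub k.*2.+1 h1) (q := Sub k.*2.+2 h2)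
  (erefl _) (erefl _) l12 e1 e2.
rewrite cnt => /(congr1 (@complex.Re R)); rewrite ReD /= => tr.
rewrite /block_charge; move: tr; case: ifP => _ tr; lra.
Qed.

Lemma unit_Hhat (x y : R) : Hhat m gamma v x y \in unitmx.
Proof.
have [r0|r0] := eqVneq (hypot x y) 0.
  move/eqP: (r0); rewrite sqrtr_eq0 => h.
  have [-> ->] : x = 0 /\ y = 0.
    have := sqr_ge0 x; have := sqr_ge0 y => hy hx.
    by split; apply/eqP; rewrite -sqrf_eq0 eq_le ?hx ?hy andbT; lra.
  exact: unit_Hhat0.
have [U [U1 U2 _ UH]] := @Hhat_rotation R m gamma v x y r0.
have := UH (hypot x y); rewrite ![hypot x y * _]mulrC !divfK // => <-.
have [uU uU'] := mulmx1_unit U1.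
rewrite !unitmx_mul uU uU' andbT /=.
by apply: unit_Hhat_axis => //; rewrite gt_eqF.
Qed.

Lemma chern_Hhat : chern (fun x y => negproj (Hhat m gamma v x y)) =
  (- 2^-1 * (m%:R * Num.sg (pot v m.-1)
             + \sum_(k < m.-1) k.+1%:R * block_charge k))%:C.
Proof.
have pl x y := esym (Hhat_planar m gamma v x y).
have -> : (fun x y => negproj (Hhat m gamma v x y)) =
  (fun x y => negproj (planar (Hhat m gamma v 0 0) (sigma_x R m) (sigma_y R m) x y)).
  by apply/funext => x; apply/funext => y; rewrite pl.
rewrite (@chern_rotation_family R n _ _ _ (@winding R m)) //.
- rewrite /sgn_at pl trace_winding_sigma_x.
  rewrite winding_trace_at0 ?sub0r ?mulNr ?mulrN //.
  have [S hS] := exists_sign (Hhat_herm m gamma v 0 0) (unit_Hhat 0 0).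
  rewrite (negproj_sign (Hhat_herm m gamma v 0 0) hS).
  exact: (sign_neg_proj (Hhat_herm m gamma v 0 0) hS).
- exact: Hhat_herm.
- exact: sigma_x_herm.
- exact: sigma_y_herm.
- exact: sigma_x_sq.
- by move=> x y; rewrite pl unit_Hhat.
- by move=> x y; rewrite pl; exact: winding_comm.
- move=> x y r0; have [U [U1 U2 UL UH]] := @Hhat_rotation R m gamma v x y r0.
  by exists U; split => // t; rewrite !pl.
Qed.

End Fixed.
End Phases.

(** * Thresholds and the value of the invariant *)

Section Arithmetic.
Variable R : realType.

Lemma sum_above N a : (a <= N)%N ->
  \sum_(k < N) k.+1%:R * (a < k.+1)%N%:R =
  (N%:R * (N%:R + 1) - a%:R * (a%:R + 1)) / 2 :> R.
Proof.
elim: N => [|N IH] aN.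
  by have -> : a = 0%N by [lia]; rewrite big_ord0; lra.
rewrite big_ord_recr /=; have [hN|hN] := leqP a N.
  by rewrite IH // ltnS hN mulr1 -(natr1 N); field.
have -> : a = N.+1 by lia.
rewrite ltnn mulr0 addr0 big1; first by lra.
by move=> k _; have -> : (N.+1 < k.+1)%N = false by [have := ltn_ord k; lia]; rewrite mulr0.
Qed.

Lemma sum_below N b : (b <= N)%N ->
  \sum_(k < N) k.+1%:R * (k.+1 <= b)%N%:R = b%:R * (b%:R + 1) / 2 :> R.
Proof.
move=> bN.
have -> : \sum_(k < N) k.+1%:R * (k.+1 <= b)%N%:R =
  \sum_(k < N) k.+1%:R * (0 < k.+1)%N%:R - \sum_(k < N) k.+1%:R * (b < k.+1)%N%:R :> R.
  rewrite -sumrB; apply: eq_bigr => k _; rewrite ltn0Sn (ltnNge b).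
  by case: (k.+1 <= b)%N; rewrite /= ?mulr0 ?mulr1 ?subr0 ?subrr.
by rewrite !sum_above //; lra.
Qed.

(** The thresholds are the distances to m/2 of the integers from ceil(m/2) on. *)
Lemma delta_kE m k : delta_k R m k = (uphalf m + k)%:R - m%:R / 2.
Proof. by rewrite /delta_k natrD; ring. Qed.

Lemma delta_k_ge0 m k : 0 <= delta_k R m k.
Proof.
rewrite delta_kE.
have : (m%:R : R) <= (uphalf m + k).*2%:R by rewrite ler_nat; lia.
by rewrite -muln2 natrM; lra.
Qed.

Section Gap.
Variables (m : nat) (gamma u : R).
Hypothesis m2 : (2 <= m)%N.
Hypothesis gamma0 : 0 < gamma.
Hypothesis u0 : 0 < u.

Let m1 : 0 < m%:R - 1 :> R.
Proof. by have : (2%:R : R) <= m%:R by [rewrite ler_nat]; lra. Qed.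

Lemma delta_sqr : delta m gamma u ^+ 2 =
  gamma ^+ 2 * (m%:R - 1) ^+ 2 / u ^+ 2 + 1 / 4.
Proof.
have : 0 <= gamma ^+ 2 * (m%:R - 1) ^+ 2 / u ^+ 2.
  by apply: divr_ge0; [apply: mulr_ge0|]; exact: sqr_ge0.
by move=> h; rewrite sqr_sqrtr //; lra.
Qed.

(** As [delta_k] at 0 is 0 or 1/2, this places delta above the lowest threshold. *)
Lemma delta_gt_half : 2^-1 < delta m gamma u.
Proof.
rewrite -(ltr_pXn2r (n := 2)) ?nnegrE ?sqrtr_ge0 ?invr_ge0 //.
rewrite delta_sqr.
have : 0 < gamma ^+ 2 * (m%:R - 1) ^+ 2 / u ^+ 2.
  by apply: divr_gt0; [apply: mulr_gt0|]; exact: exprn_gt0.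
by rewrite expr2; lra.
Qed.

(** With d = k + 1 - m/2, the potentials of neighbouring layers are proportional to d - 1/2 and d +
    1/2. Their product d^2 - 1/4 accounts for the 1/4 inside [delta]. *)
Lemma layer_pot_prod v k : v ^+ 2 = u ^+ 2 ->
  gamma ^+ 2 - layer_pot m v k * layer_pot m v k.+1 =
  (u / (m%:R - 1)) ^+ 2 *
  (delta m gamma u ^+ 2 - `|k.+1%:R - m%:R / 2| ^+ 2).
Proof.
move=> vu; rewrite real_normK ?num_real // delta_sqr /layer_pot.
have -> : v / (m%:R - 1) * (k.+1%:R - (m%:R + 1) / 2) *
   (v / (m%:R - 1) * (k.+2%:R - (m%:R + 1) / 2)) =
   v ^+ 2 / (m%:R - 1) ^+ 2 * ((k.+1%:R - m%:R / 2) ^+ 2 - 1 / 4).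
  rewrite -[k.+2%:R]natr1; move: (k.+1%:R) (m%:R) m1 => i M M1.
  by field; rewrite gt_eqF.
rewrite vu; move: (m%:R) m1 (k.+1%:R) => M M1 i.
by field; rewrite !gt_eqF.
Qed.

Lemma layer_pot_prod_lt v k : v ^+ 2 = u ^+ 2 ->
  (layer_pot m v k * layer_pot m v k.+1 < gamma ^+ 2) =
  (`|k.+1%:R - m%:R / 2| < delta m gamma u).
Proof.
move=> vu; rewrite -subr_gt0 (layer_pot_prod k vu) pmulr_rgt0; last first.
  by rewrite exprn_gt0 // divr_gt0.
by rewrite subr_gt0 ltr_pXn2r ?nnegrE ?sqrtr_ge0.
Qed.

Lemma layer_pot_prod_eq v k : v ^+ 2 = u ^+ 2 ->
  (layer_pot m v k * layer_pot m v k.+1 == gamma ^+ 2) =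
  (`|k.+1%:R - m%:R / 2| == delta m gamma u).
Proof.
move=> vu; rewrite eq_sym -subr_eq0 (layer_pot_prod k vu) mulf_eq0 sqrf_eq0.
rewrite gt_eqF ?divr_gt0 //= subr_eq0 eq_sym.
by rewrite eqrXn2 ?sqrtr_ge0.
Qed.

Variable j : nat.
Hypothesis jm : (j <= m./2 - 1)%N.
Hypothesis dj : delta_k R m j < delta m gamma u.
Hypothesis dj1 : below_delta m j.+1 (delta m gamma u).

(** Here a = m/2 + delta_j. Among the indices i = k + 1 of the blocks, those with m - a <= i <= a
    are indefinite, and those outside are definite. *)
Local Notation a := (uphalf m + j)%N.

Let delta_lt i : (0 < i)%N -> (i < m)%N -> (a < i)%N || (i + a < m)%N ->
  delta m gamma u < `|i%:R - m%:R / 2|.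
Proof.
(* For the infinite threshold a = m - 1, and no index strictly between 0 and m lies outside the
   range. *)
move=> i0 im hi; move: dj1; rewrite /below_delta; case: eqP => [e|_ h]; first by lia.
apply: (lt_le_trans h); rewrite delta_kE.
case/orP: hi => hi.
  have : (uphalf m + j.+1)%:R <= i%:R :> R by rewrite ler_nat; lia.
  by move=> hle; apply: (le_trans _ (ler_norm _)); lra.
have : (i + (uphalf m + j.+1))%:R <= m%:R :> R by rewrite ler_nat; lia.
rewrite natrD => hle; rewrite -normrN; apply: (le_trans _ (ler_norm _)); lra.
Qed.

Let delta_gt i : (i <= a)%N -> (m <= i + a)%N -> `|i%:R - m%:R / 2| < delta m gamma u.
Proof.
move=> h1 h2; apply: le_lt_trans dj; rewrite delta_kE.
have : i%:R <= (uphalf m + j)%:R :> R by rewrite ler_nat.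
have : m%:R <= (i + (uphalf m + j))%:R :> R by rewrite ler_nat.
rewrite natrD => h3 h4; rewrite ler_norml; apply/andP; split; lra.
Qed.

Lemma gap_nondeg v k : v ^+ 2 = u ^+ 2 -> (k.+1 < m)%N ->
  layer_pot m v k * layer_pot m v k.+1 != gamma ^+ 2.
Proof.
move=> vu km; rewrite (layer_pot_prod_eq k vu).
have [h|h] := boolP ((a < k.+1)%N || (k.+1 + a < m)%N).
  by rewrite gt_eqF // delta_lt.
by rewrite lt_eqF // delta_gt //; lia.
Qed.

Lemma block_charge_opp k :
  block_charge m gamma (- u) k = - block_charge m gamma u k.
Proof.
have potN i : layer_pot m (- u) i = - layer_pot m u i :> R.
  by rewrite /layer_pot !mulNr.
rewrite /block_charge !potN mulrNN sgrN.
by case: ifP => _; rewrite ?oppr0 // mulrN.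
Qed.

Lemma block_chargeE k : (k.+1 < m)%N -> block_charge m gamma u k =
  2 * ((a < k.+1)%N%:R - (k.+1 <= m - a.+1)%N%:R).
Proof.
move=> km; rewrite /block_charge layer_pot_prod_lt //.
have w0 : 0 < u / (m%:R - 1) by rewrite divr_gt0.
have [h|h] := ltnP a k.+1.
  have -> : (k.+1 <= m - a.+1)%N = false by lia.
  have d := delta_lt (ltn0Sn k) km (introT orP (or_introl h)).
  rewrite ltNge (ltW d) /= subr0 gtr0_sg // /layer_pot pmulr_rgt0 //.
  have : (uphalf m + j.+1)%:R <= k.+1%:R :> R by rewrite ler_nat; lia.
  have : m%:R <= (uphalf m).*2%:R :> R by rewrite ler_nat; lia.
  rewrite natrD -natr1 -muln2 natrM.
  have : 0 <= j%:R :> R by rewrite ler0n.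
  lra.
have [l|l] := ltnP (k.+1 + a) m.
  have -> : (k.+1 <= m - a.+1)%N = true by lia.
  have d := delta_lt (ltn0Sn k) km (introT orP (or_intror l)).
  rewrite ltNge (ltW d) /= sub0r ltr0_sg // /layer_pot pmulr_rlt0 //.
  have : (k.+1 + (a + 1))%:R <= m%:R :> R by rewrite ler_nat; lia.
  have : m%:R <= (uphalf m).*2%:R :> R by rewrite ler_nat; lia.
  rewrite !natrD -muln2 natrM.
  have : 0 <= j%:R :> R by rewrite ler0n.
  lra.
have -> : (k.+1 <= m - a.+1)%N = false by lia.
by rewrite delta_gt // subrr mulr0.
Qed.

(** Reversing u reverses every term, so the two halves add up to m^2 - a(a + 1) - (m - a)(m - a -
    1); substituting a = m/2 + delta_j gives the formula. *)
Lemma BDI_phase : BDI m gamma u = (BDI_val R m j)%:C.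
Proof.
have un0 : u != 0 by rewrite gt_eqF.
have nu : (- u) ^+ 2 = u ^+ 2 by rewrite sqrrN.
rewrite /BDI /PiS /PiN.
rewrite (chern_Hhat m2 gamma0 _ (fun k => gap_nondeg (v := - u) nu (k := k))) ?oppr_eq0 //.
rewrite (chern_Hhat m2 gamma0 un0 (fun k => gap_nondeg (v := u) (erefl _) (k := k))).
have potN i : layer_pot m (- u) i = - layer_pot m u i :> R.
  by rewrite /layer_pot !mulNr.
have -> : \sum_(k < m.-1) k.+1%:R * block_charge m gamma (- u) k =
  - \sum_(k < m.-1) k.+1%:R * block_charge m gamma u k.
  by rewrite -sumrN; apply: eq_bigr => k _; rewrite block_charge_opp mulrN.
have pl : 0 < layer_pot m u m.-1.
  rewrite /layer_pot pmulr_rgt0 ?divr_gt0 // prednK; last by lia.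
  by have := m1; lra.
rewrite potN sgrN gtr0_sg // -rmorphB; congr (_%:C).
have -> : \sum_(k < m.-1) k.+1%:R * block_charge m gamma u k =
  2 * (\sum_(k < m.-1) k.+1%:R * (a < k.+1)%N%:R -
       \sum_(k < m.-1) k.+1%:R * (k.+1 <= m - a.+1)%N%:R).
  rewrite -sumrB mulr_sumr; apply: eq_bigr => k _; have := ltn_ord k => hk.
  by rewrite block_chargeE; [ring|lia].
rewrite sum_above; last by lia.
rewrite sum_below; last by lia.
have e1 : (m.-1)%:R = m%:R - 1 :> R by rewrite -subn1 natrB //; lia.
have e2 : (m - a.+1)%:R = m%:R - (a%:R + 1) :> R by rewrite natrB ?natr1 //; lia.
rewrite e1 e2 /BDI_val delta_kE.
by field.
Qed.

End Gap.
End Arithmetic.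

Theorem theorem2p3 (R : realType) (m : nat) : (2 <= m)%N ->
  (* the formula BDI(gamma,u) = BDI_j on delta_j < delta(gamma,u) < delta_{j+1} *)
  (forall (gamma u : R) (j : nat), 0 < gamma -> 0 < u -> (j <= m./2 - 1)%N ->
     delta_k R m j < delta m gamma u -> below_delta m j.+1 (delta m gamma u) ->
     BDI m gamma u = (BDI_val R m j)%:C)
  (* the floor(m/2) values BDI_j are pairwise distinct *)
  /\ (forall j j' : nat, (j <= m./2 - 1)%N -> (j' <= m./2 - 1)%N -> j <> j' ->
        BDI_val R m j <> BDI_val R m j')
  (* every admissible (gamma,u) lies in one of the phases *)
  /\ (forall gamma u : R, 0 < gamma -> 0 < u ->
        (forall k : nat, (k <= m./2 - 1)%N -> delta m gamma u <> delta_k R m k) ->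
        exists2 j : nat, (j <= m./2 - 1)%N &
          delta_k R m j < delta m gamma u /\ below_delta m j.+1 (delta m gamma u))
  (* every phase is realized *)
  /\ (forall j : nat, (j <= m./2 - 1)%N ->
        exists gamma u : R, [/\ 0 < gamma, 0 < u, delta_k R m j < delta m gamma u
                              & below_delta m j.+1 (delta m gamma u)]).
Proof.
move=> m2; split; [|split; [|split]].
- by move=> gamma u j g0 u0 jm dj dj1; exact: BDI_phase.
- move=> j j' _ _ jj' /eqP; rewrite /BDI_val !delta_kE !natrD.
  have d0 := delta_k_ge0 R m j; have d0' := delta_k_ge0 R m j'.
  rewrite delta_kE natrD in d0; rewrite delta_kE natrD in d0'.
  have jn : (j%:R : R) - j'%:R != 0 by rewrite subr_eq0 eqr_nat; apply/eqP.
  move: (j%:R) (j'%:R) (uphalf m)%:R (m%:R) jn d0 d0' => x y h M jn d0 d0' /eqP e.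
  (* The values differ by 2 (j - j') (delta_j + delta_j' + 1) up to sign, and the last factor is at
     least 1. *)
  have : (x - y) * (h + x - M / 2 + (h + y - M / 2) + 1) = 0 by lra.
  by move/eqP; rewrite mulf_eq0 (negPf jn) /= => /eqP; lra.
- move=> gamma u g0 u0 hne.
  have base : delta_k R m 0 < delta m gamma u.
    apply: le_lt_trans (delta_gt_half m2 g0 u0); rewrite delta_kE addn0.
    have : ((uphalf m).*2%:R : R) <= m.+1%:R by rewrite ler_nat; lia.
    by rewrite -muln2 natrM -(natr1 m); lra.
  (* The induction finds the largest threshold below delta among the first N + 1. *)
  have step N : (N <= m./2 - 1)%N -> exists2 j : nat, (j <= N)%N &
     delta_k R m j < delta m gamma u /\ (j = N \/ delta m gamma u < delta_k R m j.+1).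
    elim: N => [|N IH] hN; first by exists 0%N => //; split => //; left.
    have [|j jN [h1 h2]] := IH; first by lia.
    case: h2 => [e|h2]; last by exists j; [lia|split => //; right].
    have [lt|ge] := ltP (delta_k R m N.+1) (delta m gamma u).
      by exists N.+1 => //; split => //; left.
    exists j; first lia; split => //; right; rewrite e lt_def ge andbT.
    by apply/eqP => e'; apply: (hne N.+1).
  have [j jN [h1 h2]] := step _ (leqnn (m./2 - 1)).
  exists j => //; split => //; rewrite /below_delta; case: eqP => // hj.
  by case: h2 => // e; exfalso; lia.
(* Consecutive thresholds are 1 apart, so 3/4 stays between them; it also exceeds 1/2, which makes
   x^2 - 1/4 positive even when delta_j = 0. With u = 1, gamma is then solved from delta = x. *)
- move=> j jm; pose x : R := delta_k R m j + 3 / 4.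
  have d0 := delta_k_ge0 R m j.
  have m1 : 0 < m%:R - 1 :> R.
    by have : (2%:R : R) <= m%:R by [rewrite ler_nat]; lra.
  have x2 : 0 < x ^+ 2 - 1 / 4.
    have -> : x ^+ 2 - 1 / 4 = (x - 1 / 2) * (x + 1 / 2) by field.
    by rewrite mulr_gt0 // /x; lra.
  exists (Num.sqrt (x ^+ 2 - 1 / 4) / (m%:R - 1)), 1.
  have dx : delta m (Num.sqrt (x ^+ 2 - 1 / 4) / (m%:R - 1)) 1 = x.
    rewrite /delta expr1n divr1 exprMn sqr_sqrtr ?(ltW x2) // exprVn.
    rewrite divfK ?expf_neq0 ?gt_eqF // subrK sqrtr_sqr ger0_norm // /x; lra.
  rewrite dx; split => //.
  - by rewrite divr_gt0 // sqrtr_gt0.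
  - by rewrite /x; lra.
  - rewrite /below_delta; case: eqP => // _; rewrite /x !delta_kE addnS -natr1; lra.
Qed.
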